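(* Let $n\ge 1$, let $a=(a_1,\dots,a_n)$ with $a_i\in\mathbb{Q}$, $0<a_i<1$, and let $q(a|z)$ be the associated mirror map. For a good prime $p$ let $C_p(a)$ denote the following condition (equalities of multisets, i.e. equalities up to a permutation of the entries): - if $n=2$: $\{\delta_p(a_1),\delta_p(a_2)\}=\{a_1,a_2\}$ or $\{\delta_p(a_1),\delta_p(a_2)\}=\{1-a_1,1-a_2\}$; - if $n\neq 2$: $\{\delta_p(a_1),\dots,\delta_p(a_n)\}=\{a_1,\dots,a_n\}$. Then: 1. For arbitrary $n$: (i) for every good prime $p$, if $C_p(a)$ holds then $q(a|z)$ is $p$-integral; (ii) if $C_p(a)$ holds for every good prime $p$, then $q(a|z)$ is $N$-integral. 2. For $n\in\{1,2,3,4\}$: $q(a|z)$ is $N$-integral if and only if $C_p(a)$ holds for every good prime $p$.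
   Context: For $a=(a_1,\dots,a_n)$ with $a_i\in\mathbb{Q}$, $0<a_i<1$, put $(x)_k=x(x+1)\cdots(x+k-1)$, $(x)_0=1$, and define the formal power series $$F(a|z)=\sum_{k=0}^\infty \frac{(a_1)_k\cdots(a_n)_k}{k!^n}z^k,\qquad G(a|z)=\sum_{k=1}^\infty \frac{(a_1)_k\cdots(a_n)_k}{k!^n}\Big[\sum_{j=1}^n\sum_{i=0}^{k-1}\Big(\frac1{a_j+i}-\frac1{1+i}\Big)\Big]z^k .$$ The mirror map is $q(a|z)=z\exp\big(G(a|z)/F(a|z)\big)\in\mathbb{Q}[[z]]$. A prime $p$ is good (for $a$) if $p$ does not divide the denominator of any $a_i$. A power series $f\in\mathbb{Q}[[z]]$ is $p$-integral if $p$ does not divide the denominator of any of its coefficients (equivalently $f\in\mathbb{Z}_p[[z]]$). The mirror map $q(a|z)$ is $N$-integral if there exists a natural number $N\ge 1$ such that $q(a|Nz)$ has integer coefficients. Dwork operator: for a prime $p$ and $x\in\mathbb{Q}$ whose denominator is not divisible by $p$, $\delta_p(x)=\frac{x+x_0}{p}$, where $x_0$ is the unique integer with $0\le x_0\le p-1$ such that $p$ does not divide the denominator of $\frac{x+x_0}{p}$. *)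

(* Defs.v *)
From mathcomp Require Import all_boot all_order all_algebra.
Set Implicit Arguments.
Unset Strict Implicit.
Unset Printing Implicit Defensive.
Import Order.TTheory GRing.Theory Num.Theory.
Local Open Scope ring_scope.

(* A formal power series over rat is given by its sequence of coefficients:   *)
(* f stands for the sum of the f k * z ^ k.                                   *)
Definition fps := nat -> rat.

Definition fps_one : fps := fun k => (k == 0%N)%:R.

Definition fps_sub (f g : fps) : fps := fun k => f k - g k.

Definition fps_mul (f g : fps) : fps :=
  fun k => \sum_(i < k.+1) f i * g (k - i)%N.

Definition fps_pow (f : fps) (m : nat) : fps := iter m (fps_mul f) fps_one.

(* 1 / f = \sum_m (1 - f) ^ m, meaningful only if f 0 = 1; the sum may then   *)
(* be truncated since (1 - f) ^ m has no term of degree k < m.                *)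
Definition fps_inv (f : fps) : fps :=
  fun k => \sum_(m < k.+1) fps_pow (fps_sub fps_one f) m k.

(* exp f = \sum_m f ^ m / m!, meaningful only if f 0 = 0; the sum may then be *)
(* truncated since f ^ m has no term of degree k < m.                         *)
Definition fps_exp (f : fps) : fps :=
  fun k => \sum_(m < k.+1) fps_pow f m k / (m`!)%:R.

Definition fps_mulX (f : fps) : fps := fun k => if k is j.+1 then f j else 0.

(* The series f(c z). *)
Definition fps_dilate (c : rat) (f : fps) : fps := fun k => c ^+ k * f k.

Definition pochhammer (x : rat) (k : nat) : rat := \prod_(i < k) (x + i%:R).

Definition hyp_coef n (a : n.-tuple rat) (k : nat) : rat :=
  (\prod_(j < n) pochhammer (tnth a j) k) / (k`!)%:R ^+ n.

Definition hypF n (a : n.-tuple rat) : fps := fun k => hyp_coef a k.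

(* The coefficient of z ^ 0 is 0 because the inner sums are then empty. *)
Definition hypG n (a : n.-tuple rat) : fps := fun k =>
  hyp_coef a k *
  \sum_(j < n) \sum_(i < k) ((tnth a j + i%:R)^-1 - (1 + i%:R)^-1).

Definition mirror_map n (a : n.-tuple rat) : fps :=
  fps_mulX (fps_exp (fps_mul (hypG a) (fps_inv (hypF a)))).

Definition p_integral_rat (p : nat) (x : rat) : bool := ~~ (p %| `|denq x|)%N.

Definition p_integral (p : nat) (f : fps) : Prop :=
  forall k, p_integral_rat p (f k).

Definition N_integral (f : fps) : Prop :=
  exists2 N : nat, (0 < N)%N &
    forall k, fps_dilate N%:R f k \is a Num.int.

Definition good_prime n (a : n.-tuple rat) (p : nat) : Prop :=
  prime p /\ forall i : 'I_n, p_integral_rat p (tnth a i).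

(* When p is prime and x is p-integral there is exactly one such i; the       *)
(* default value 0 is never used in that case.                                *)
Definition dwork_digit (p : nat) (x : rat) : nat :=
  if [pick i : 'I_p | p_integral_rat p ((x + i%:R) / p%:R)] is Some i
  then val i else 0%N.

Definition dwork (p : nat) (x : rat) : rat := (x + (dwork_digit p x)%:R) / p%:R.

Definition dwork_cond n (a : n.-tuple rat) (p : nat) : Prop :=
  if n == 2%N then
    perm_eq (map (dwork p) a) a \/
    perm_eq (map (dwork p) a) (map (fun x => 1 - x) a)
  else perm_eq (map (dwork p) a) a.

(* Main.v *)
Require Import Defs.
From HB Require Import structures.
From mathcomp Require Import all_boot all_order all_algebra.
From mathcomp Require boolp.
From mathcomp Require Import ring lra zify.
Import Order.TTheory GRing.Theory Num.Theory.
Local Open Scope ring_scope.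
Set Implicit Arguments.
Unset Strict Implicit.
Unset Printing Implicit Defensive.

(** Write [f_a = G(a|z) / F(a|z)], so that [q(a|z) = z exp f_a], and let [a']
    be the tuple of the [dwork p a_i] at a good prime [p].

    p-integrality.  By the lemma of Dieudonne and Dwork ([dieudonne_dwork]),
    [exp f] is p-integral if and only if [p f(z) - f(z^p)] vanishes modulo [p].
    Dwork's congruence ([logq_dwork]) states that [p f_a(z) - f_a'(z^p)] vanishes
    modulo [p] for all parameters that are p-integral.  Hence [q(a|z)] is
    p-integral if and only if [f_a'] and [f_a] agree modulo [p]
    ([mirror_criterion]).  Both series are symmetric in the parameters, so they
    are equal when [a'] is a permutation of [a].  For [n = 2] the parameters [1 - a]
    also give the same series ([logq_reflection]): by Euler's transformation the
    two solutions at [0] of the differential equation for [1 - a] are those for [a]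
    times a common power of [1 - z].

    Dwork's congruence.  Let [A(k)] be the coefficients of [F] and [A(k) H(k)] those
    of [G], with [A'], [H'] the analogues for [a'].  For [v < p] one has
    [A(v + p j) = A'(j) w(j)] and [H(v + p j) = H'(j) / p + ...], where
    [w(i) = w(j)] modulo [p^(s+1)] as soon as [i = j] modulo [p^s].  After
    multiplication by the denominators the coefficient of [z^(v + p K)] in the
    congruence becomes the sum over [j <= K] of
    [H'(j) A'(j) A'(K - j) (w(j) - w(K - j))].  Such sums are integral for every
    function [u] in place of [w] that satisfies [u(i) = u(j)] modulo [p^s] whenever
    [i = j] modulo [p^s] ([log_balance]).  This is an induction on [K]: cut the sum
    along the residue classes of [j] modulo [p] and substitute the two relations
    above.  The class of [c] contributes [1/p] times a sum of the same kind for [a']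
    and for the quotient of [K - c] by [p], and pairing [c] with the residue of
    [K - c] lets the new weights appear as differences [X(j) - X(K' - j)]; as [X]
    is a constant plus [p] times an admissible function, the factor [1/p]
    disappears.

    N-integrality.  At the finitely many primes that are not good all coefficients
    grow at most geometrically p-adically, so that a dilation makes them integral
    ([dilate_mirror_bad]).

    Converse for [n <= 4].  Let [d] be a common denominator of [a].  If [q(a|z)] is
    N-integral, then for all large primes the criterion gives a congruence between
    two series that belong to the finite set of the [f_b] with [b] in [(1/d) Z],
    and therefore an equality.  Multiplying large primes yields [f_b = f_a] for
    every [b] obtained from [a] by a unit modulo [d] ([logq_unit_invariant]): every
    unit has a representative all of whose prime factors are large, so that no theorem
    on primes in progressions is needed.  In particular [f_a' = f_a] for every good
    prime, and [f_(1-a) = f_a], [f_(1-a') = f_a'].  It remains to see that the first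
    coefficients of [f] determine the parameters.  With the parameters centred at
    [1/2] the reflection changes the sign of the odd elementary symmetric functions;
    the equality [f_(1-a) = f_a] forces them to vanish for [n = 3, 4], and the few
    remaining ones are read off from one or two coefficients. *)

(** * Rationals without p in the denominator *)

(** The form in which sums and products are handled: any denominator prime to
    [p] will do. *)
Lemma p_integralP p x : prime p ->
  reflect (exists2 d : nat, ~~ (p %| d)%N & x * d%:R \is a Num.int)
          (p_integral_rat p x).
Proof.
move=> p_pr; apply: (iffP idP) => [xp|[d pd /intrP[m xd]]].
  exists `|denq x|%N => //.
  by rewrite pmulrn absz_denq -numqE intr_int.
apply: contra pd => /dvdn_trans; apply.
have e : (numq x * d%:Z = m * denq x).
  apply: (@intr_inj rat); rewrite !rmorphM /= numqE -xd -!pmulrn; ring.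
have : (denq x %| numq x * d%:Z)%Z by rewrite e dvdz_mull.
rewrite Gauss_dvdzr; first by rewrite dvdzE absz_nat.
by rewrite coprimezE coprime_sym coprime_num_den.
Qed.

Section Localization.

Variables (p : nat) (p_pr : prime p).

(** The proof that [p] is prime serves as an index from which the subring
    instance below is inferred. *)
Definition Zloc of prime p : {pred rat} := p_integral_rat p.
Local Notation Zl := (Zloc p_pr).

Let p_gt0 : (0 < p)%N := prime_gt0 p_pr.

Let pr_neq0 : p%:R != 0 :> rat.
Proof. by rewrite pnatr_eq0 -lt0n. Qed.

Fact Zloc_subring : subring_closed Zl.
Proof.
have PP := p_integralP _ p_pr.
split.
- by apply/PP; exists 1%N; rewrite ?mulr1 // dvdn1 neq_ltn prime_gt1 // orbT.
- move=> x y /PP[d pd xd] /PP[e pe ye]; apply/PP; exists (d * e)%N.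
    by rewrite Euclid_dvdM // negb_or pd.
  rewrite natrM; have -> : (x - y) * (d%:R * e%:R)
    = (x * d%:R) * e%:R - (y * e%:R) * d%:R by ring.
  by rewrite rpredB // rpredM ?natr_int.
- move=> x y /PP[d pd xd] /PP[e pe ye]; apply/PP; exists (d * e)%N.
    by rewrite Euclid_dvdM // negb_or pd.
  by rewrite natrM mulrACA rpredM.
Qed.

HB.instance Definition _ := GRing.isSubringClosed.Build rat Zl Zloc_subring.

Lemma ZlocE x : (x \in Zl) = p_integral_rat p x. Proof. by []. Qed.

Lemma Zloc_nat n : n%:R \in Zl.
Proof. exact: rpred_nat. Qed.

Lemma Zloc_int (x : rat) : x \is a Num.int -> x \in Zl.
Proof.
by move=> xi; apply/p_integralP => //; exists 1%N; rewrite ?mulr1 // dvdn1 neq_ltn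
   prime_gt1 // orbT.
Qed.

Lemma Zloc_inv_nat d : ~~ (p %| d)%N -> (d%:R)^-1 \in Zl.
Proof.
move=> pd; apply/p_integralP => //; exists d => //.
by rewrite mulVf ?pnatr_eq0 //; apply: contraNneq pd => ->.
Qed.

Lemma Zloc_int_div s (m : int) :
  (m%:~R / (p ^ s)%:R \in Zl) = ((p ^ s)%:Z %| m)%Z.
Proof.
have P0 : (p ^ s)%:R != 0 :> rat by rewrite pnatr_eq0 -lt0n expn_gt0 p_gt0.
apply/idP/idP => [/p_integralP-/(_ p_pr)[d pd /intrP[k e]]|/dvdzP[k ->]].
  have : ((p ^ s)%:Z %| m * d%:Z)%Z.
    apply/dvdzP; exists k; apply: (@intr_inj rat).
    rewrite !rmorphM /= -e -!pmulrn; field.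
    by [].
  rewrite Gauss_dvdzl // coprimezE !absz_nat coprimeXl //.
  by rewrite prime_coprime.
by rewrite rmorphM /= -pmulrn mulfK // Zloc_int // intr_int.
Qed.

Lemma Zloc_nat_div s n : (n%:R / (p ^ s)%:R \in Zl) = (p ^ s %| n)%N.
Proof. by rewrite -[n%:R]/(n%:Z%:~R) Zloc_int_div dvdzE !absz_nat. Qed.

(** The ring is a discrete valuation ring with uniformizer [p]: what [p] does
    not divide is a unit. *)
Lemma Zloc_unit x : x \in Zl -> x / p%:R \notin Zl -> x^-1 \in Zl.
Proof.
move=> xi; have [d pd /intrP[m e]] := p_integralP _ p_pr xi.
have d0 : d%:R != 0 :> rat by rewrite pnatr_eq0; apply: contraNneq pd => ->.
have xE : x = m%:~R / d%:R by rewrite -e mulfK.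
move=> xp; have pm : ~~ (p%:Z %| m)%Z.
  apply: contra xp => pm; rewrite xE mulrAC rpredM ?Zloc_inv_nat //.
  by rewrite -[p]expn1 Zloc_int_div expn1.
have m0 : (`|m|%N)%:R != 0 :> rat.
  by rewrite pnatr_eq0 absz_eq0; apply: contraNneq pm => ->.
have mi : (m%:~R : rat)^-1 \in Zl.
  rewrite [m]intEsg rmorphM /= invfM rpredM //; last first.
    by rewrite -pmulrn Zloc_inv_nat // -(dvdzE p%:Z).
  by case: sgzP => _; rewrite ?invr0 ?invr1 ?rpred0 ?rpred1 // invrN1 rpredN rpred1.
by rewrite xE invf_div rpredM // Zloc_nat.
Qed.

(** Natural numbers represent all residues modulo [p ^ s], since a
    denominator prime to [p] has an inverse modulo [p ^ s]. *)
Lemma Zloc_approx s x : x \in Zl -> exists X : nat, (x - X%:R) / (p ^ s)%:R \in Zl.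
Proof.
move=> xi; have [d pd /intrP[m e]] := p_integralP _ p_pr xi.
have d0 : d%:R != 0 :> rat by rewrite pnatr_eq0; apply: contraNneq pd => ->.
have xE : x = m%:~R / d%:R by rewrite -e mulfK.
have ps0 : (0 < p ^ s)%N by rewrite expn_gt0 p_gt0.
have cop : coprimez d (p ^ s)%:Z.
  by rewrite coprimezE !absz_nat coprimeXr // coprime_sym prime_coprime.
have [[u v] /= uv] := coprimezP _ _ cop.
pose Y : int := (m * u %% (p ^ s)%:Z)%Z.
have Y0 : 0 <= Y by rewrite modz_ge0 // eqz_nat -lt0n.
exists `|Y|%N.
have -> : (`|Y|%N)%:R = Y%:~R :> rat by rewrite pmulrn gez0_abs.
have YE : Y = m * u - (m * u %/ (p ^ s)%:Z)%Z * (p ^ s)%:Z.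
  by apply/esym/eqP; rewrite subr_eq addrC -divz_eq.
have uvQ : u%:~R * d%:R + v%:~R * (p ^ s)%:R = 1 :> rat.
  by have /= := congr1 (fun z : int => z%:~R : rat) uv; rewrite rmorphD !rmorphM.
have P0 : (p ^ s)%:R != 0 :> rat by rewrite pnatr_eq0 -lt0n.
set w := (m * u %/ _)%Z in YE.
have -> : (x - Y%:~R) / (p ^ s)%:R = m%:~R * v%:~R * d%:R^-1 + w%:~R.
  rewrite YE rmorphB !rmorphM /= -pmulrn xE.
  apply: (mulIf P0); rewrite mulfVK //; apply: (mulIf d0).
  rewrite !(mulrDl, mulrBl) mulfVK // mulrAC mulfVK //.
  have : (m%:~R : rat) * (u%:~R * d%:R + v%:~R * (p ^ s)%:R) = m%:~R.
    by rewrite uvQ mulr1.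
  lra.
by rewrite rpredD ?rpredM ?Zloc_inv_nat ?Zloc_int ?intr_int.
Qed.

End Localization.

(** The hypothesis on [L] says that [L] counts the indices below [N] congruent
    to [c]; it is left to the user, who knows [L] in a convenient form. *)
Lemma big_residue_class (R : Type) (idx : R) (op : Monoid.law idx)
    (p c L N : nat) (g : nat -> R) :
  (c < p)%N -> (forall l, (l < L)%N = (c + p * l < N)%N) ->
  \big[op/idx]_(i < N | (i %% p == c)%N) g i =
  \big[op/idx]_(l < L) g (c + p * l)%N.
Proof.
move=> cp hL; have p0 : (0 < p)%N by apply: leq_ltn_trans cp.
rewrite -(big_mkord (fun i => i %% p == c)%N g).
rewrite -(big_mkord xpredT (fun l => g (c + p * l)%N)).
rewrite -big_filter -(big_map (fun l => c + p * l)%N xpredT g).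
congr (\big[op/idx]_(i <- _) _); rewrite /index_iota !subn0.
apply: (irr_sorted_eq ltn_trans ltnn).
- by rewrite sorted_filter ?iota_ltn_sorted //; apply: ltn_trans.
- rewrite (homo_sorted _ _ (iota_ltn_sorted 0 L)) // => x y xy.
  by rewrite ltn_add2l ltn_pmul2l.
move=> i; rewrite mem_filter mem_iota add0n /=; apply/andP/mapP.
- case=> /eqP e iN; exists (i %/ p)%N; last by rewrite {1}(divn_eq i p) e addnC mulnC.
  by rewrite mem_iota add0n hL -e mulnC addnC -divn_eq.
- case=> l; rewrite mem_iota add0n => /andP[_]; rewrite hL => lN ->; split=> //.
  by rewrite mulnC addnC modnMDl modn_small.
Qed.

Section PowerOverFactorial.

Variables (p : nat) (p_pr : prime p).
Local Notation Zl := (Zloc p_pr).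

(** The valuation of [m!] is less than [m], for all primes including 2: the
    factors of [m!] divisible by [p] are [p, 2p, ..., Lp] with [L = m / p], and
    [L <= m / 2]. *)
Lemma Zloc_expfact m : (0 < m)%N -> p%:R ^+ m.-1 / m`!%:R \in Zl.
Proof.
have p1 := prime_gt1 p_pr; have p0 := prime_gt0 p_pr.
have pr0 : p%:R != 0 :> rat by rewrite pnatr_eq0 -lt0n.
elim/ltn_ind: m => m IH m0; pose L := (m %/ p)%N.
have factE k : k`!%:R = \prod_(i < k) i.+1%:R :> rat.
  by rewrite -natr_prod fact_prod big_add1 /= big_mkord.
(* [U] collects the factors [i + 1] of [m!] that are prime to [p]. *)
pose U : rat := \prod_(i < m | (i %% p != p.-1)%N) i.+1%:R.
have eL : m`!%:R = U * (p%:R ^+ L * L`!%:R).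
  rewrite factE (bigID (fun i : 'I_m => (i %% p == p.-1)%N)) /= mulrC.
  congr (_ * _); rewrite (@big_residue_class _ _ _ p p.-1 L m (fun i => i.+1%:R)).
  - rewrite factE -[L in p%:R ^+ L]card_ord -prodr_const -big_split /=.
    by apply: eq_bigr => l _; rewrite -natrM -addSn prednK // mulnS.
  - by rewrite ltn_predL.
  - by move=> l; rewrite /L leq_divRL //; lia.
have Ui : U^-1 \in Zl.
  rewrite -prodfV rpred_prod // => i hi; apply: Zloc_inv_nat.
  apply: contra hi => /dvdnP[q e].
  have -> : (i : nat) = (q.-1 * p + p.-1)%N by case: q e => [|q]; lia.
  by rewrite modnMDl modn_small // ltn_predL.
have L0 : (L`!%:R : rat) != 0 by rewrite pnatr_eq0 -lt0n fact_gt0.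
have [e|Lp] := posnP L.
  by rewrite eL e expr0 mul1r fact0 mulr1 rpredM // -natrX Zloc_nat.
have Lm : (2 * L <= m)%N.
  by apply: leq_trans (leq_trunc_div m p); rewrite mulnC leq_mul.
have -> : p%:R ^+ m.-1 / m`!%:R =
   U^-1 * (p%:R ^+ L.-1 / L`!%:R) * p%:R ^+ (m - 2 * L)%N.
  have -> : m.-1 = (L.-1 + L + (m - 2 * L))%N by lia.
  rewrite eL invfM invfM !exprD.
  have : p%:R ^+ L != 0 :> rat by rewrite expf_neq0.
  by move=> pL; field; rewrite L0 pL andbT; apply/prodf_neq0 => i _; rewrite pnatr_eq0.
apply: rpredM; last first.
  by apply: rpredX; apply: Zloc_nat.
by apply: rpredM Ui (IH L _ Lp); rewrite /L ltn_Pdiv.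
Qed.

End PowerOverFactorial.

(** * Formal power series over the rationals *)

Lemma fpsP (f g : fps) : f =1 g -> f = g.
Proof. exact: boolp.funext. Qed.

HB.instance Definition _ := boolp.gen_eqMixin fps.
HB.instance Definition _ := boolp.gen_choiceMixin fps.

Definition fps_zero : fps := fun=> 0.
Definition fps_opp (f : fps) : fps := fun k => - f k.
Definition fps_add (f g : fps) : fps := fun k => f k + g k.

Fact fps_addA : associative fps_add.
Proof. by move=> f g h; apply: fpsP => k; apply: addrA. Qed.
Fact fps_addC : commutative fps_add.
Proof. by move=> f g; apply: fpsP => k; apply: addrC. Qed.
Fact fps_add0 : left_id fps_zero fps_add.
Proof. by move=> f; apply: fpsP => k; apply: add0r. Qed.
Fact fps_addN : left_inverse fps_zero fps_opp fps_add.
Proof. by move=> f; apply: fpsP => k; apply: addNr. Qed.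

HB.instance Definition _ :=
  GRing.isZmodule.Build fps fps_addA fps_addC fps_add0 fps_addN.

Definition fps_trunc (M : nat) (f : fps) : {poly rat} := \poly_(i < M) f i.

(** Truncation to polynomials transports the ring laws to series. *)
Lemma fps_mul_trunc M f g k : (k < M)%N ->
  fps_mul f g k = (fps_trunc M f * fps_trunc M g)`_k.
Proof.
move=> kM; rewrite coefM; apply: eq_bigr => i _; rewrite !coef_poly.
have iM : (i < M)%N by apply: leq_ltn_trans kM; rewrite -ltnS.
by rewrite iM (leq_ltn_trans (leq_subr _ _) kM).
Qed.

Fact fps_mulC : commutative fps_mul.
Proof.
by move=> f g; apply: fpsP => k; rewrite !(@fps_mul_trunc k.+1) // mulrC.
Qed.
Fact fps_mulA : associative fps_mul.
Proof.
have E f g h k : fps_mul f (fps_mul g h) k =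
    (fps_trunc k.+1 f * (fps_trunc k.+1 g * fps_trunc k.+1 h))`_k.
  rewrite (@fps_mul_trunc k.+1) // !coefM; apply: eq_bigr => i _; congr (_ * _).
  by rewrite coef_poly ltnS leq_subr (@fps_mul_trunc k.+1) // ltnS leq_subr.
move=> f g h; apply: fpsP => k.
by rewrite [in RHS]fps_mulC !E mulrA mulrC.
Qed.
Fact fps_mul1 : left_id fps_one fps_mul.
Proof.
move=> f; apply: fpsP => k; rewrite /fps_mul big_ord_recl /= subn0 mul1r.
by rewrite big1 ?addr0 // => i _; rewrite mul0r.
Qed.
Fact fps_mulDl : left_distributive fps_mul fps_add.
Proof.
move=> f g h; apply: fpsP => k; rewrite /fps_mul /fps_add -big_split /=.
by apply: eq_bigr => i _; rewrite mulrDl.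
Qed.
Fact fps_1neq0 : fps_one != 0.
Proof.
by apply/eqP => /(congr1 (fun f : fps => f 0%N))/eqP; rewrite oner_eq0.
Qed.

HB.instance Definition _ := GRing.Zmodule_isComNzRing.Build fps
  fps_mulA fps_mulC fps_mul1 fps_mulDl fps_1neq0.

Lemma fpsD (f g : fps) k : (f + g) k = f k + g k. Proof. by []. Qed.
Lemma fpsN (f : fps) k : (- f) k = - f k. Proof. by []. Qed.
Lemma fpsB (f g : fps) k : (f - g) k = f k - g k. Proof. by []. Qed.
Lemma fps0 k : (0 : fps) k = 0. Proof. by []. Qed.
Lemma fps1 k : (1 : fps) k = (k == 0%N)%:R. Proof. by []. Qed.
Lemma fpsM (f g : fps) k : (f * g) k = \sum_(i < k.+1) f i * g (k - i)%N.
Proof. by []. Qed.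
Lemma fpsM0 (f g : fps) : (f * g) 0%N = f 0%N * g 0%N.
Proof. by rewrite fpsM big_ord1. Qed.
Lemma fps_sumE I (r : seq I) (P : pred I) (F : I -> fps) k :
  (\sum_(i <- r | P i) F i) k = \sum_(i <- r | P i) F i k.
Proof. by elim/big_rec2: _ => // i x y _ <-. Qed.
Lemma fpsMn (f : fps) n k : (f *+ n) k = f k *+ n.
Proof. by elim: n => // n IH; rewrite !mulrS fpsD IH. Qed.
Lemma fpsX0 (f : fps) m : (f ^+ m) 0%N = f 0%N ^+ m.
Proof. by elim: m => // m IH; rewrite !exprS fpsM0 IH. Qed.

Lemma fps_powE (f : fps) m : fps_pow f m = f ^+ m.
Proof. by elim: m => // m IH; rewrite /fps_pow iterS exprS -IH. Qed.

Lemma fpsX_vanish (f : fps) m k : f 0%N = 0 -> (k < m)%N -> (f ^+ m) k = 0.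
Proof.
move=> f0; elim: m k => // m IH k km; rewrite exprS fpsM big1 // => i _.
have [->|i0] := posnP i; first by rewrite f0 mul0r.
by rewrite IH ?mulr0 //; have := ltn_ord i; lia.
Qed.

Lemma fpsM_eq (f g f' g' : fps) k :
  (forall i, (i <= k)%N -> f i = f' i) -> (forall i, (i <= k)%N -> g i = g' i) ->
  (f * g) k = (f' * g') k.
Proof.
move=> hf hg; rewrite !fpsM; apply: eq_bigr => i _.
by rewrite hf ?hg ?leq_subr // -ltnS.
Qed.

Lemma fpsX_eq (f f' : fps) m k :
  (forall i, (i <= k)%N -> f i = f' i) -> (f ^+ m) k = (f' ^+ m) k.
Proof.
elim: m k => // m IH k h; rewrite !exprS; apply: fpsM_eq => // i ik.
by apply: IH => j ji; apply: h; apply: leq_trans ik.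
Qed.

(** The derivation [z d/dz]. *)
Definition theta (f : fps) : fps := fun k => k%:R * f k.

Fact theta_zmod : zmod_morphism theta.
Proof. by move=> f g; apply: fpsP => k; rewrite /theta !fpsB mulrBr. Qed.
HB.instance Definition _ := GRing.isZmodMorphism.Build fps fps theta theta_zmod.

Lemma theta1 : theta 1 = 0.
Proof. by apply: fpsP => -[|k]; rewrite /theta ?mul0r // fps1 mulr0. Qed.

Lemma thetaM (f g : fps) : theta (f * g) = theta f * g + f * theta g.
Proof.
apply: fpsP => k; rewrite /theta fpsD !fpsM mulr_sumr -big_split /=.
apply: eq_bigr => i _; have ik : (i <= k)%N by rewrite -ltnS.
by rewrite -{1}(subnKC ik) natrD; ring.
Qed.

Lemma thetaX (f : fps) m : theta (f ^+ m.+1) = (f ^+ m * theta f) *+ m.+1.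
Proof.
elim: m => [|m IH]; first by rewrite expr1 expr0 mul1r.
rewrite [in LHS]exprS thetaM IH mulrnAr [in RHS]mulrS.
by congr (_ + _ *+ _); rewrite ?exprS; ring.
Qed.

(** At degree [k] the equation reads [k X_k] = an expression in the lower
    coefficients.  The functional equation of [exp] is an instance. *)
Lemma theta_uniq (g X Y : fps) : g 0%N = 0 -> X 0%N = Y 0%N ->
  theta X = X * g -> theta Y = Y * g -> X = Y.
Proof.
move=> g0 XY0 hX hY; apply: fpsP; elim/ltn_ind => -[//|k] IH.
apply: (@mulfI _ (k.+1%:R : rat)); first by rewrite pnatr_eq0.
rewrite -[LHS]/(theta X k.+1) -[RHS]/(theta Y k.+1) hX hY !fpsM.
rewrite big_ord_recr [in RHS]big_ord_recr /= subnn g0 !mulr0 !addr0.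
by apply: eq_bigr => i _; rewrite IH.
Qed.

Lemma fps_invE (f : fps) k : fps_inv f k = \sum_(m < k.+1) ((1 - f) ^+ m) k.
Proof. by apply: eq_bigr => m _; rewrite fps_powE. Qed.

(** The geometric series of [1 - f] telescopes. *)
Lemma fps_mulV (f : fps) : f 0%N = 1 -> f * fps_inv f = 1.
Proof.
move=> f0; have v0 : (1 - f) 0%N = 0 by rewrite fpsB f0 subrr.
apply: fpsP => k.
have -> : (f * fps_inv f) k = (f * \sum_(m < k.+1) (1 - f) ^+ m) k.
  rewrite !fpsM; apply: eq_bigr => i _; congr (_ * _).
  rewrite fps_invE fps_sumE.
  have le : ((k - i).+1 <= k.+1)%N by rewrite ltnS leq_subr.
  rewrite (big_ord_widen _ (fun m => ((1 - f) ^+ m) (k - i)%N) le) big_mkcond /=.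
  apply: eq_bigr => m _; case: ltnP => // h.
  by rewrite fpsX_vanish // -ltnS.
have -> : f * (\sum_(m < k.+1) (1 - f) ^+ m) = 1 - (1 - f) ^+ k.+1.
  rewrite -[X in _ = X - _](expr1n fps k.+1) subrXX subKr; congr (_ * _).
  by apply: eq_bigr => m _; rewrite expr1n mul1r.
by rewrite fpsB fpsX_vanish ?subr0.
Qed.

Lemma fps_expE (f : fps) M k : f 0%N = 0 -> (k < M)%N ->
  fps_exp f k = \sum_(m < M) (f ^+ m) k / m`!%:R.
Proof.
move=> f0 kM; rewrite /fps_exp.
rewrite (big_ord_widen _ (fun m => fps_pow f m k / m`!%:R) kM) big_mkcond /=.
apply: eq_bigr => m _; rewrite fps_powE; case: ltnP => // h.
by rewrite fpsX_vanish ?mul0r.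
Qed.

Lemma fps_exp0 (f : fps) : fps_exp f 0%N = 1.
Proof. by rewrite /fps_exp big_ord1 /= fact0 divr1. Qed.

Lemma theta_exp (f : fps) : f 0%N = 0 -> theta (fps_exp f) = fps_exp f * theta f.
Proof.
move=> f0; apply: fpsP => k; rewrite {1}/theta (@fps_expE f k.+2) // mulr_sumr.
rewrite big_ord_recl /= expr0 fps1.
have -> : k%:R * ((k == 0%N)%:R / 0`!%:R) = 0 :> rat.
  by case: k => [|k]; rewrite !(mul0r, mulr0).
rewrite add0r fpsM.
under [RHS]eq_bigr => i _.
  rewrite (@fps_expE f k.+1) // mulr_suml; over.
rewrite exchange_big /=; apply: eq_bigr => m _.
rewrite mulrA -[k%:R * _]/(theta (f ^+ m.+1) k) thetaX fpsMn.
rewrite fpsM -[_ *+ m.+1]mulr_natr -mulrA.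
have -> : m.+1%:R / (lift ord0 m)`!%:R = (m`!%:R)^-1 :> rat.
  rewrite factS natrM; have : m.+1%:R != 0 :> rat by rewrite pnatr_eq0.
  have : m`!%:R != 0 :> rat by rewrite pnatr_eq0 -lt0n fact_gt0.
  by move=> h1 h2; rewrite invfM mulrA divff // mul1r.
by rewrite mulr_suml; apply: eq_bigr => i _; ring.
Qed.

Lemma theta0 (f : fps) : theta f 0%N = 0. Proof. exact: mul0r. Qed.

Lemma fps_expD (f g : fps) : f 0%N = 0 -> g 0%N = 0 ->
  fps_exp (f + g) = fps_exp f * fps_exp g.
Proof.
move=> f0 g0; apply: (@theta_uniq (theta (f + g))).
- exact: theta0.
- by rewrite fpsM0 !fps_exp0 mulr1.
- by apply: theta_exp; rewrite fpsD f0 g0 addr0.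
- by rewrite thetaM !theta_exp // raddfD /=; ring.
Qed.

Lemma fps_expMn (f : fps) p : f 0%N = 0 -> fps_exp (f *+ p) = fps_exp f ^+ p.
Proof.
move=> f0; elim: p => [|p IH].
  rewrite mulr0n expr0; apply: (@theta_uniq 0); rewrite ?mulr0 ?theta1 ?fps_exp0 //.
  by rewrite theta_exp // raddf0 mulr0.
by rewrite mulrS exprS fps_expD // ?IH // fpsMn f0 mul0rn.
Qed.

(** * Integral series and the lemma of Dieudonne and Dwork *)

(** The substitution [f(z ^ p)]. *)
Definition phi (p : nat) (f : fps) : fps :=
  fun k => if (p %| k)%N then f (k %/ p)%N else 0.

Section Phi.

Variables (p : nat) (p_gt0 : (0 < p)%N).

Fact phi_zmod : zmod_morphism (phi p).
Proof.
by move=> f g; apply: fpsP => k; rewrite fpsB /phi; case: ifP; rewrite ?subrr.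
Qed.
HB.instance Definition _ := GRing.isZmodMorphism.Build fps fps (phi p) phi_zmod.

(** Only the indices divisible by [p] contribute to the convolution. *)
Lemma phi_mulE (f g : fps) N :
  (phi p g * f) N = \sum_(j < (N %/ p).+1) g j * f (N - p * j)%N.
Proof.
pose G i := g (i %/ p)%N * f (N - i)%N.
rewrite fpsM (eq_bigr (fun i : 'I_N.+1 => if (i %% p == 0)%N then G i else 0));
  last first.
  by move=> i _; rewrite /phi /dvdn /G; case: ifP; rewrite ?mul0r.
rewrite -big_mkcond (@big_residue_class _ _ _ p 0 (N %/ p).+1 N.+1 G) //.
  by apply: eq_bigr => j _; rewrite /G add0n mulKn.
by move=> l; rewrite add0n !ltnS leq_divRL // mulnC.
Qed.

Lemma phiM (f g : fps) : phi p (f * g) = phi p f * phi p g.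
Proof.
apply: fpsP => N; rewrite phi_mulE {1}/phi; case: ifP => [/dvdnP[q ->]|pN].
  rewrite mulnK // fpsM; apply: eq_bigr => j _.
  by rewrite mulnC -mulnBr /phi dvdn_mulr // mulKn.
rewrite big1 // => j _; rewrite /phi ifN ?mulr0 //.
have jN : (p * j <= N)%N by rewrite mulnC -leq_divRL // -ltnS.
by rewrite dvdn_subl ?pN // dvdn_mulr.
Qed.

Lemma phi1 : phi p 1 = 1.
Proof.
apply: fpsP => -[|k]; rewrite /phi ?dvdn0 ?div0n // !fps1 /=.
case: ifP => // pk; rewrite eqn0Ngt divn_gt0 //.
by rewrite dvdn_leq.
Qed.

Lemma phiX (f : fps) m : phi p (f ^+ m) = phi p f ^+ m.
Proof. by elim: m => [|m IH]; rewrite ?expr0 ?phi1 // !exprS phiM IH. Qed.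

Lemma phi0 (f : fps) : phi p f 0%N = f 0%N.
Proof. by rewrite /phi dvdn0 div0n. Qed.

Lemma phi_exp (f : fps) : f 0%N = 0 -> phi p (fps_exp f) = fps_exp (phi p f).
Proof.
move=> f0; apply: fpsP => k; rewrite {1}/phi.
rewrite (@fps_expE (phi p f) k.+1) ?phi0 //; case: ifP => pk; last first.
  by rewrite big1 // => m _; rewrite -phiX /phi pk mul0r.
rewrite (@fps_expE f k.+1) ?ltnS ?leq_div //.
by apply: eq_bigr => m _; rewrite -phiX /phi pk.
Qed.

End Phi.

Section IntegralSeries.

Variables (p : nat) (p_pr : prime p).
Local Notation Zl := (Zloc p_pr).
Let p_gt0 : (0 < p)%N := prime_gt0 p_pr.
Let pr_neq0 : p%:R != 0 :> rat.
Proof. by rewrite pnatr_eq0 -lt0n. Qed.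

Definition Zfps of prime p : {pred fps} :=
  fun f => boolp.asbool (p_integral p f).
Local Notation Zf := (Zfps p_pr).

Lemma ZfpsP (f : fps) : reflect (forall k, f k \in Zl) (f \in Zf).
Proof. exact: boolp.asboolP. Qed.

Fact Zfps_subring : subring_closed Zf.
Proof.
split.
- by apply/ZfpsP => k; rewrite fps1 Zloc_nat.
- by move=> f g /ZfpsP fi /ZfpsP gi; apply/ZfpsP => k; rewrite fpsB rpredB.
- move=> f g /ZfpsP fi /ZfpsP gi; apply/ZfpsP => k; rewrite fpsM.
  by apply: rpred_sum => i _; apply: rpredM.
Qed.
HB.instance Definition _ := GRing.isSubringClosed.Build fps Zf Zfps_subring.

Lemma Zfps_inv (f : fps) : f \in Zf -> fps_inv f \in Zf.
Proof.
move=> fi; apply/ZfpsP => k; rewrite fps_invE; apply: rpred_sum => m _.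
by apply/ZfpsP/rpredX; rewrite rpredB ?rpred1.
Qed.

Lemma Zfps_phi (f : fps) : f \in Zf -> phi p f \in Zf.
Proof.
move=> /ZfpsP fi; apply/ZfpsP => k; rewrite /phi; case: ifP => // _.
exact: rpred0.
Qed.

Definition pfps (f : fps) : Prop := forall k, f k / p%:R \in Zl.

Lemma pfpsP (f : fps) : pfps f <-> exists2 g, g \in Zf & f = g *+ p.
Proof.
split=> [h|[g /ZfpsP gi ->] k]; last by rewrite fpsMn -[X in X / _]mulr_natr mulfK.
exists (fun k => f k / p%:R); first by apply/ZfpsP.
by apply: fpsP => k; rewrite fpsMn -[RHS]mulr_natr mulfVK.
Qed.

Lemma pfpsMl (f g : fps) : f \in Zf -> pfps g -> pfps (f * g).
Proof.
move=> fi /pfpsP[g' gi ->]; apply/pfpsP; exists (f * g'); first exact: rpredM.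
by rewrite mulrnAr.
Qed.

Lemma pfpsD (f g : fps) : pfps f -> pfps g -> pfps (f + g).
Proof. by move=> hf hg k; rewrite fpsD mulrDl rpredD. Qed.

Lemma pfpsN (f : fps) : pfps f -> pfps (- f).
Proof. by move=> hf k; rewrite fpsN mulNr rpredN. Qed.

Lemma pfpsMn (f : fps) : f \in Zf -> pfps (f *+ p).
Proof. by move=> fi; apply/pfpsP; exists f. Qed.

(** The terms [p ^ m g ^ m / m!] with [m > 0] are divisible by [p]. *)
Lemma exp_pfps (h : fps) : h 0%N = 0 -> pfps h -> pfps (fps_exp h - 1).
Proof.
move=> h0 /pfpsP[g gi hE] k; rewrite fpsB (@fps_expE _ k.+1) //.
rewrite big_ord_recl /= expr0 divr1 addrAC subrr add0r mulr_suml.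
apply: rpred_sum => m _; rewrite hE -(mulr_natl g p) exprMn -natrX mulr_natl fpsMn.
rewrite -[X in X / _ / _]mulr_natr natrX.
have -> : (g ^+ bump 0 m) k * p%:R ^+ bump 0 m / (bump 0 m)`!%:R / p%:R =
  (g ^+ m.+1) k * (p%:R ^+ (m.+1).-1 / m.+1`!%:R).
  by rewrite /bump add1n /= (exprS p%:R); field; rewrite pr_neq0 pnatr_eq0 -lt0n fact_gt0.
rewrite rpredM ?Zloc_expfact //.
by apply/ZfpsP/rpredX.
Qed.

Lemma fpsM_low (r s : fps) k : (forall i, (i < k)%N -> r i = 0) ->
  forall i, (i <= k)%N -> (r * s) i = r i * s 0%N.
Proof.
move=> rk i ik; rewrite fpsM big_ord_recr /= subnn big1 ?add0r // => j _.
by rewrite rk ?mul0r // (leq_trans (ltn_ord j)).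
Qed.

(** By induction on the degree: [exp h] differs from [exp t], where [t] is the part
    of [h] in degrees less than [k], by exactly [h_k] in degree [k]. *)
Lemma pfps_exp (h : fps) : h 0%N = 0 -> pfps (fps_exp h - 1) -> pfps h.
Proof.
move=> h0 he; elim/ltn_ind => k IH.
have [->|k0] := posnP k; first by rewrite h0 mul0r rpred0.
pose t : fps := fun i => if (i < k)%N then h i else 0; pose r := h - t.
have t0 : t 0%N = 0 by rewrite /t k0.
have r_low i : (i < k)%N -> r i = 0 by rewrite /r fpsB /t => ->; rewrite subrr.
have rk : r k = h k by rewrite /r fpsB /t ltnn subr0.
have r0 := r_low _ k0.
have tp : pfps t.
  by move=> i; rewrite /t; case: ifP => [/IH//|_]; rewrite mul0r rpred0.
have expr_low i : (i <= k)%N -> fps_exp r i = (1 + r) i.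
  move=> ik; have [->|i0] := posnP i; first by rewrite fps_exp0 fpsD r0 addr0.
  rewrite (@fps_expE _ i.+1) // big_ord_recl /= expr0 fps1 fact0 divr1 fpsD.
  congr (_ + _); case: i i0 ik => // i _ ik.
  rewrite big_ord_recl /= /bump add1n expr1 divr1 big1 ?addr0 // => m _.
  by rewrite exprS (@fpsM_low _ _ k) // fpsX0 !add1n r0 expr0n /= mulr0 mul0r.
have hE : h = t + r by rewrite /r addrC subrK.
have ek : fps_exp h k = fps_exp t k + h k.
  rewrite {1}hE fps_expD // (@fpsM_eq _ _ (fps_exp t) (1 + r)) //.
  by rewrite mulrC mulrDl mul1r fpsD (@fpsM_low _ _ k) // fps_exp0 mulr1 rk.
have -> : h k = (fps_exp h - 1) k - (fps_exp t - 1) k.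
  by rewrite !fpsB ek; ring.
by rewrite mulrBl rpredB //; apply: exp_pfps.
Qed.

Lemma Zloc_fermat c : c \in Zl -> (c ^+ p - c) / p%:R \in Zl.
Proof.
move=> ci; have [X hX] := Zloc_approx 1 ci; rewrite expn1 in hX.
have -> : (c ^+ p - c) / p%:R = (c ^+ p - X%:R ^+ p) / p%:R - (c - X%:R) / p%:R
    + (X%:R ^+ p - X%:R) / p%:R by field.
apply: rpredD; last first.
  have le : (X <= X ^ p)%N.
    by case: (X) => // x; rewrite -{1}(expn1 x.+1) leq_pexp2l.
  rewrite -natrX -natrB // -{2}(expn1 p) Zloc_nat_div expn1 -eqn_mod_dvd //.
  by apply/eqP/fermat_little.
apply: rpredB => //; rewrite subrXX mulrAC rpredM // rpred_sum // => i _.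
by rewrite rpredM ?rpredX ?Zloc_nat.
Qed.

Definition mono (c : rat) (i : nat) : fps := fun k => if k == i then c else 0.

Lemma mono_mulE c i (f : fps) k :
  (mono c i * f) k = if (i <= k)%N then c * f (k - i)%N else 0.
Proof.
rewrite fpsM; case: leqP => ik; last first.
  rewrite big1 // => j _; rewrite /mono; case: eqP => [e|_]; last by rewrite mul0r.
  by have := ltn_ord j; rewrite e ltnS leqNgt ik.
have ik' : (i < k.+1)%N by [].
rewrite (bigD1 (Ordinal ik')) //= /mono eqxx.
rewrite big1 ?addr0 // => j ji; rewrite ifN ?mul0r //.
Qed.

Lemma monoM c d i j : mono c i * mono d j = mono (c * d) (i + j).
Proof.
apply: fpsP => k; rewrite mono_mulE /mono; case: leqP => ik.
  by rewrite -{2}(subnKC ik) eqn_add2l; case: eqP; rewrite ?mulr0.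
by rewrite ifN //; lia.
Qed.

Lemma monoX c i m : mono c i ^+ m = mono (c ^+ m) (m * i).
Proof.
elim: m => [|m IH]; first by apply: fpsP => k; rewrite !expr0 fps1 /mono; case: eqP.
by rewrite !exprS IH monoM mulSn.
Qed.

Lemma phi_mono c i : phi p (mono c i) = mono c (p * i).
Proof.
apply: fpsP => k; rewrite /phi /mono; case: ifP => [/dvdnP[q ->]|pk].
  by rewrite mulnK // mulnC eqn_pmul2l.
by rewrite ifN //; apply: contraFneq pk => ->; rewrite dvdn_mulr.
Qed.

Lemma pfps_exprD (f g : fps) : f \in Zf -> g \in Zf ->
  pfps ((f + g) ^+ p - (f ^+ p + g ^+ p)).
Proof.
move=> fi gi.
pose S n := \sum_(i < n.-1) f ^+ (n - i.+1) * g ^+ i.+1 *+ 'C(n, i.+1).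
have exprD n : (0 < n)%N -> (f + g) ^+ n = f ^+ n + g ^+ n + S n.
  case: n => // n _; rewrite exprDn big_ord_recl big_ord_recr /=.
  rewrite subn0 subnn !bin0 !binn !expr0 mulr1 mul1r !mulr1n -addrA.
  by rewrite [_ + g ^+ _]addrC.
rewrite exprD // addrAC subrr add0r.
have add0 : pfps 0 by move=> k; rewrite fps0 mul0r rpred0.
rewrite /S; apply: (big_ind pfps) => //; first exact: pfpsD.
move=> i _.
have ip : (0 < i.+1 < p)%N by have := ltn_ord i; lia.
have /dvdnP[c ->] := prime_dvd_bin p_pr ip; rewrite mulrnA.
by apply: pfpsMn; rewrite rpredMn // rpredM ?rpredX.
Qed.

(** The congruence [E(z) ^ p = E(z ^ p)] modulo [p], by adding one monomial
    after the other. *)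
Lemma pfps_frobenius (E : fps) : E \in Zf -> pfps (E ^+ p - phi p E).
Proof.
move=> /ZfpsP Ei k.
pose T M : fps := fun i => if (i < M)%N then E i else 0.
have Ti M : T M \in Zf.
  by apply/ZfpsP => i; rewrite /T; case: ifP => // _; apply: rpred0.
have monoi c i : c \in Zl -> mono c i \in Zf.
  by move=> ci; apply/ZfpsP => j; rewrite /mono; case: ifP => // _; apply: rpred0.
have TS M : T M.+1 = T M + mono (E M) M.
  apply: fpsP => i; rewrite fpsD /T /mono ltnS.
  by case: ltngtP => [h|h|->]; rewrite ?addr0 ?add0r.
have H M : pfps (T M ^+ p - phi p (T M)).
  elim: M => [|M IH].
    have -> : T 0%N = 0 by apply: fpsP.
    have -> : phi p 0 = 0 by apply: fpsP => i; rewrite /phi; case: ifP.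
    by move=> i; rewrite expr0n eqn0Ngt p_gt0 /= subrr fps0 mul0r rpred0.
  have hm : pfps (mono (E M) M ^+ p - phi p (mono (E M) M)).
    rewrite monoX phi_mono => i; rewrite fpsB /mono; case: ifP => _.
      exact: Zloc_fermat.
    by rewrite subrr mul0r rpred0.
  have := pfpsD (pfps_exprD (Ti M) (monoi _ M (Ei M))) (pfpsD IH hm).
  have phiD : phi p (T M.+1) = phi p (T M) + phi p (mono (E M) M).
    by rewrite TS; apply: raddfD.
  by rewrite phiD TS; set X := (X in pfps X -> _) => h;
     set Y := (Y in pfps Y); have -> : Y = X by rewrite /X /Y; ring.
have := H k.+1 k; rewrite !fpsB (@fpsX_eq (T k.+1) E).
  rewrite [phi p (T _) k]/phi [in phi p E k]/phi; case: ifP => // pk.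
  by rewrite /T ltnS leq_div.
by move=> i ik; rewrite /T ltnS ik.
Qed.

(** Both directions use [E(z) ^ p = E(z ^ p) exp (p f(z) - f(z ^ p))] for
    [E = exp f].  If [E] is integral, the Frobenius congruence shows that the last
    factor is [1] modulo [p].  Conversely the coefficient of degree [k] on the left
    is [p E_k] plus an expression in the lower coefficients, which the Frobenius
    congruence compares with the right-hand side modulo [p]. *)
Theorem dieudonne_dwork (f : fps) : f 0%N = 0 ->
  fps_exp f \in Zf <-> pfps (f *+ p - phi p f).
Proof.
move=> f0; set h := f *+ p - phi p f; set E := fps_exp f.
have h0 : h 0%N = 0 by rewrite /h fpsB fpsMn phi0 f0 mul0rn subr0.
have E0 : E 0%N = 1 by apply: fps_exp0.
have EpE : E ^+ p = phi p E * fps_exp h.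
  rewrite -fps_expMn // phi_exp // -fps_expD ?phi0 //.
  by rewrite /h addrC subrK.
split=> [Ei|hp].
  have phE0 : phi p E 0%N = 1 by rewrite phi0.
  apply: pfps_exp => //.
  have -> : fps_exp h - 1 = fps_inv (phi p E) * (E ^+ p - phi p E).
    rewrite EpE mulrBr mulrA [fps_inv _ * phi p E]mulrC.
    by rewrite fps_mulV // mul1r.
  apply: pfpsMl; last exact: pfps_frobenius.
  exact/Zfps_inv/Zfps_phi.
have /pfpsP[R Ri RE] := exp_pfps h0 hp.
have {}RE : fps_exp h = 1 + R *+ p by rewrite -RE addrC subrK.
apply/ZfpsP; elim/ltn_ind => k IH; have [->|k0] := posnP k.
  by rewrite E0 rpred1.
pose T : fps := fun i => if (i < k)%N then E i else 0; pose r := E - T.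
have Ti : T \in Zf.
  apply/ZfpsP => i; rewrite /T; case: ifP => [/IH//|_]; exact: rpred0.
have T0 : T 0%N = 1 by rewrite /T k0.
have r_low i : (i < k)%N -> r i = 0 by rewrite /r fpsB /T => ->; rewrite subrr.
have rk : r k = E k by rewrite /r fpsB /T ltnn subr0.
have Tr : T + r = E by rewrite /r addrC subrK.
clearbody r; have Em m i : (i <= k)%N -> (E ^+ m) i = (T ^+ m + r *+ m) i.
  elim: m i => [|m IHm] i ik; first by rewrite mulr0n addr0.
  rewrite exprS (@fpsM_eq E _ (T + r) (T ^+ m + r *+ m)); last 2 first.
  - by move=> j _; rewrite Tr.
  - by move=> j ji; apply: IHm; apply: leq_trans ik.
  rewrite mulrDl mulrDr -exprS mulrnAr [T * r]mulrC !fpsD !fpsMn.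
  rewrite !(fpsM_low _ r_low) // fpsD fpsX0 T0 expr1n fpsMn.
  by rewrite (r_low 0%N) // mul0rn addr0 !mulr1 [in RHS]mulrSr addrA.
have phiE i : (i <= k)%N -> phi p E i = phi p T i.
  move=> ik; rewrite /phi; case: ifP => // pi; rewrite /T ifT //.
  have [->|i0] := posnP i; first by rewrite div0n.
  by apply: leq_trans ik; rewrite ltn_Pdiv // prime_gt1.
have /pfpsP[S /ZfpsP Si SE] := pfps_frobenius Ti.
have e : (E ^+ p) k = (phi p T * (1 + R *+ p)) k.
  by rewrite EpE RE; apply: fpsM_eq.
(* The terms not divisible by [p] cancel by the Frobenius congruence for [T]. *)
have {}e : E k = (phi p T * R) k - S k.
  apply: (mulIf pr_neq0).
  move: e; rewrite Em // mulrDr mulr1 mulrnAr.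
  have -> : T ^+ p = phi p T + S *+ p by rewrite -SE addrC subrK.
  rewrite !fpsD !fpsMn rk => e.
  rewrite mulrBl !mulr_natr; apply/eqP; rewrite eq_sym subr_eq -(inj_eq (addrI (phi p T k))).
  by rewrite -e addrA addrAC.
rewrite e rpredB //; apply/ZfpsP; rewrite rpredM //; exact: Zfps_phi.
Qed.

End IntegralSeries.

(** * Pochhammer symbols modulo powers of a prime *)

Lemma big_cyclic_shift (R : Type) (idx : R) (op : Monoid.com_law idx) (M c : nat)
    (g : nat -> R) : (forall i, g (i + M)%N = g i) ->
  \big[op/idx]_(i < M) g (c + i)%N = \big[op/idx]_(i < M) g i.
Proof.
move=> gM; elim: c => [//|c <-]; case: M gM => [|M] gM; first by rewrite !big_ord0.
rewrite big_ord_recr [in RHS]big_ord_recl /= addn0 Monoid.mulmC.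
by rewrite addSnnS gM; congr (op _ _); apply: eq_bigr => i _; rewrite addSnnS.
Qed.

Section DworkCongruence.

Variables (p : nat) (p_pr : prime p).
Local Notation Zl := (Zloc p_pr).
Local Notation digit := (dwork_digit p).
Let p_gt0 : (0 < p)%N := prime_gt0 p_pr.
Let pr_neq0 : p%:R != 0 :> rat.
Proof. by rewrite pnatr_eq0 -lt0n. Qed.
Let pX_neq0 s : (p ^ s)%:R != 0 :> rat.
Proof. by rewrite pnatr_eq0 -lt0n expn_gt0 p_gt0. Qed.

Lemma digit_lt x : (digit x < p)%N.
Proof. by rewrite /dwork_digit; case: pickP => [i _|_] /=. Qed.

Lemma Zloc_shift s x X i : (x - X%:R) / (p ^ s)%:R \in Zl ->
  ((x + i%:R) / (p ^ s)%:R \in Zl) = (p ^ s %| X + i)%N.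
Proof.
move=> xX; rewrite -(Zloc_nat_div p_pr) natrD.
have -> : (x + i%:R) / (p ^ s)%:R =
  (x - X%:R) / (p ^ s)%:R + (X%:R + i%:R) / (p ^ s)%:R by ring.
by rewrite rpredDl.
Qed.

(** The digit of [x] is the residue of [- x] modulo [p]. *)
Lemma digitP x i : x \in Zl -> ((x + i%:R) / p%:R \in Zl) = (i %% p == digit x)%N.
Proof.
move=> xi; have [X hX] := Zloc_approx 1 xi.
have E j : ((x + j%:R) / p%:R \in Zl) = (p %| X + j)%N.
  by rewrite -{1}(expn1 p) (Zloc_shift _ hX) expn1.
have hd : (p %| X + digit x)%N.
  rewrite /dwork_digit; case: pickP => [j|no]; first by rewrite -ZlocE E.
  have lt : ((p - X %% p) %% p < p)%N by rewrite ltn_mod.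
  have := no (Ordinal lt); rewrite -(ZlocE p_pr) E /=.
  rewrite /dvdn modnDmr -modnDml subnKC ?modnn ?eqxx //.
  by rewrite ltnW // ltn_mod.
rewrite E -[in RHS](modn_small (digit_lt x)) -(eqn_modDl X).
by rewrite (eqP hd).
Qed.

Lemma dwork_Zloc x : x \in Zl -> dwork p x \in Zl.
Proof. by move=> xi; rewrite /dwork digitP // modn_small ?digit_lt. Qed.

Lemma digit1 : digit 1 = p.-1.
Proof.
apply/esym/eqP; rewrite -{1}(@modn_small p.-1 p) ?ltn_predL // -digitP ?rpred1 //.
by rewrite -[1]/(1%:R) -natrD add1n prednK // divff // rpred1.
Qed.

Lemma dwork1 : dwork p 1 = 1.
Proof. by rewrite /dwork digit1 -[1]/(1%:R) -natrD add1n prednK // divff. Qed.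

(** The numbers [x + i] divisible by [p] are the [p (x' + l)], where [x'] is
    the Dwork transform of [x]: this is the reason for its definition. *)
Lemma dworkE x l : x + (digit x + p * l)%:R = p%:R * (dwork p x + l%:R).
Proof. by rewrite /dwork natrD natrM; field. Qed.

(** Stated for an arbitrary function [g] of [x + i] in order to apply to the
    products of the [x + i] and to the sums of their inverses. *)
Lemma big_digit (R : Type) (idx : R) (op : Monoid.com_law idx) x (g : rat -> R)
    v j : (v < p)%N ->
  \big[op/idx]_(i < v + p * j) g (x + i%:R) =
  op (\big[op/idx]_(i < v + p * j | (i %% p != digit x)%N) g (x + i%:R))
     (op (\big[op/idx]_(l < j) g (p%:R * (dwork p x + l%:R)))
         (if (digit x < v)%N then g (p%:R * (dwork p x + j%:R)) else idx)).
Proof.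
move=> vp; rewrite (bigID (fun i : 'I__ => (i %% p == digit x)%N)) /= Monoid.mulmC.
congr (op _ _); have dp := digit_lt x.
rewrite (@big_residue_class _ _ _ p (digit x) (j + (digit x < v))%N _
   (fun i => g (x + i%:R))) //; last first.
  by move=> l; case: ltnP => h; apply/idP/idP => h2; nia.
case: ifP => _; rewrite ?addn1 ?addn0.
  by rewrite big_ord_recr /= dworkE; congr (op _ _); apply: eq_bigr => l _; rewrite dworkE.
by rewrite Monoid.mulm1; apply: eq_bigr => l _; rewrite dworkE.
Qed.

(** The factors of the Pochhammer symbol that are prime to [p]. *)
Definition poch_unit (x : rat) (N : nat) : rat :=
  \prod_(i < N | (i %% p != digit x)%N) (x + i%:R).

Lemma nondigit_unit x i : x \in Zl -> (i %% p != digit x)%N ->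
  (x + i%:R \in Zl) /\ ((x + i%:R)^-1 \in Zl).
Proof.
move=> xi; rewrite -digitP // => h; have xii : x + i%:R \in Zl.
  by rewrite rpredD ?Zloc_nat.
by split=> //; apply: Zloc_unit.
Qed.

Lemma poch_unit_Zloc x N : x \in Zl ->
  (poch_unit x N \in Zl) /\ ((poch_unit x N)^-1 \in Zl).
Proof.
move=> xi; rewrite /poch_unit -prodfV; split; apply: rpred_prod => i hi;
  by have [] := nondigit_unit xi hi.
Qed.

Lemma poch_unit_neq0 x N : x \in Zl -> poch_unit x N != 0.
Proof.
move=> xi; apply/prodf_neq0 => i; rewrite -digitP //.
by apply: contraNneq => ->; rewrite mul0r rpred0.
Qed.

Lemma Zloc_cong_prod M I (r : seq I) (P : pred I) (F G : I -> rat) :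
  (forall i, P i -> [/\ F i \in Zl, G i \in Zl & (F i - G i) / M \in Zl]) ->
  (\prod_(i <- r | P i) F i - \prod_(i <- r | P i) G i) / M \in Zl.
Proof.
move=> h.
suff [] : [/\ \prod_(i <- r | P i) F i \in Zl, \prod_(i <- r | P i) G i \in Zl &
  (\prod_(i <- r | P i) F i - \prod_(i <- r | P i) G i) / M \in Zl] by [].
elim/big_ind2: _ => //; first by rewrite subrr mul0r rpred0 rpred1.
move=> b a d c [ai bi ab] [ci di cd]; split; try by apply: rpredM.
have -> : (a * c - b * d) / M = a * ((c - d) / M) + d * ((a - b) / M) by ring.
by rewrite rpredD // rpredM.
Qed.

(** Modulo [p ^ s] the [x + i] prime to [p] in a period of length [p ^ s] run
    through all invertible residues, whatever [x] is.  So their product [Om] is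
    common to all [x] and cancels in quotients. *)
Lemma poch_unit_period s : exists Om : rat, forall x N, x \in Zl ->
  (poch_unit x (N + p ^ s.+1)%N - poch_unit x N * Om) / (p ^ s.+1)%:R \in Zl.
Proof.
set M := (p ^ s.+1)%N; have M0 : (0 < M)%N by rewrite expn_gt0 p_gt0.
have pM : (p %| M)%N by rewrite /M expnS dvdn_mulr.
pose g i : rat := if (p %| i)%N then 1 else (i %% M)%:R.
exists (\prod_(i < M) g i) => x N xi.
have [X hX] := Zloc_approx s.+1 xi.
have gM i : g (i + M)%N = g i by rewrite /g dvdn_addl // modnDr.
(* The same [X] serves modulo [p] to recognize the multiples of [p]. *)
have hX1 : (x - X%:R) / (p ^ 1)%:R \in Zl.
  have -> : (x - X%:R) / (p ^ 1)%:R = (x - X%:R) / (p ^ s.+1)%:R * (p ^ s)%:R.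
    by rewrite expn1 expnS natrM; field; rewrite pX_neq0.
  by rewrite rpredM ?Zloc_nat.
rewrite /poch_unit big_split_ord /= -mulrBr -mulrA rpredM //.
  by apply: rpred_prod => i /(nondigit_unit xi)[].
rewrite -(@big_cyclic_shift _ _ _ M (X + N)%N g gM) [X in X - _]big_mkcond /=.
apply: Zloc_cong_prod => i _.
have := digitP (N + i) xi; rewrite -{1}(expn1 p) (Zloc_shift _ hX1) expn1 addnA /g.
move=> <-; case: (p %| _)%N => /=; rewrite ?subrr ?mul0r ?rpred0 ?rpred1 //.
split; [by rewrite rpredD ?Zloc_nat | exact: Zloc_nat | ].
have -> : (x + (N + i)%:R - ((X + N + i) %% M)%:R) / M%:R =
   (x - X%:R) / M%:R + ((X + N + i) %/ M)%:R.
  apply: (@mulIf _ M%:R); first by rewrite pnatr_eq0 -lt0n.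
  rewrite [RHS]mulrDl !mulfVK ?pnatr_eq0 -?lt0n // -natrM.
  have := congr1 (fun k => k%:R : rat) (divn_eq (X + N + i) M).
  by rewrite /= !natrD => e; lra.
by rewrite rpredD ?Zloc_nat.
Qed.

End DworkCongruence.

(** * Hypergeometric coefficients along a residue class *)

Definition poch_ratio (x : rat) (k : nat) : rat := pochhammer x k / k`!%:R.

(** The logarithmic derivative at [e = 0] of the quotient of the Pochhammer
    symbols of [x + e] and [1 + e]. *)
Definition log_ratio (x : rat) (k : nat) : rat :=
  \sum_(i < k) ((x + i%:R)^-1 - (1 + i%:R)^-1).

Section Smooth.

Variables (p : nat) (p_pr : prime p).
Local Notation Zl := (Zloc p_pr).
Let p_gt0 : (0 < p)%N := prime_gt0 p_pr.
Let pr_neq0 : p%:R != 0 :> rat.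
Proof. by rewrite pnatr_eq0 -lt0n. Qed.
Let pX_neq0 s : (p ^ s)%:R != 0 :> rat.
Proof. by rewrite pnatr_eq0 -lt0n expn_gt0 p_gt0. Qed.

(** For [e = 0] this is the p-adic 1-Lipschitz condition, for [e = 1] the stronger
    condition with an additional factor [p].  Only the values on [0, K] matter, so
    that the reflection [u (K - j)] may use the truncated subtraction. *)
Definition smooth (e K : nat) (u : nat -> rat) : Prop :=
  (forall j, (j <= K)%N -> u j \in Zl) /\
  (forall s i j, (i <= j <= K)%N -> (p ^ s %| j - i)%N ->
     (u j - u i) / (p ^ (s + e))%:R \in Zl).
Local Notation sm := smooth.

Lemma smooth_cst e K c : c \in Zl -> sm e K (fun=> c).
Proof. by move=> ci; split=> // *; rewrite subrr mul0r rpred0. Qed.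

Lemma smoothM e K u v : sm e K u -> sm e K v -> sm e K (fun j => u j * v j).
Proof.
move=> [ui us] [vi vs]; split=> [j jK|s i j ij pij].
  by rewrite rpredM ?ui ?vi.
have /andP[ij' jK] := ij; have iK := leq_trans ij' jK.
set M := _%:R.
have -> : (u j * v j - u i * v i) / M =
   u j * ((v j - v i) / M) + v i * ((u j - u i) / M) by ring.
by apply: rpredD; apply: rpredM; [apply: ui | apply: vs | apply: vi | apply: us].
Qed.

Lemma smooth_prod e K I (r : seq I) (P : pred I) (F : I -> nat -> rat) :
  (forall i, P i -> sm e K (F i)) -> sm e K (fun j => \prod_(i <- r | P i) F i j).
Proof.
move=> h; elim: r => [|i r IH].
  have [ci cs] := @smooth_cst e K 1 (rpred1 _).
  by split=> *; rewrite !big_nil; [apply: (ci 0%N) | rewrite subrr mul0r rpred0].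
have [Pi|nPi] := boolP (P i); last first.
  by case: IH => h1 h2; split=> *; rewrite !big_cons !(negbTE nPi); auto.
have [h1 h2] := smoothM (h i Pi) IH.
by split=> *; rewrite !big_cons !Pi; auto.
Qed.

Lemma smooth_rev e K u : sm e K u -> sm e K (fun j => u (K - j)%N).
Proof.
move=> [ui us]; split=> [j jK|s i j /andP[ij jK] pij].
  by rewrite ui ?leq_subr.
rewrite -rpredN -mulNr opprB; apply: us.
  by rewrite leq_sub2l ?leq_subr.
by have -> : (K - i - (K - j) = j - i)%N by lia.
Qed.

(** Restriction to a residue class modulo [p] gains a factor [p]. *)
Lemma smooth_comp K L c u : (c + p * L <= K)%N -> sm 0 K u ->
  sm 1 L (fun j => u (c + p * j)%N).
Proof.
move=> cK [ui us]; split=> [j jL|s i j /andP[ij jL] pij].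
  by apply: ui; apply: leq_trans cK; rewrite leq_add2l leq_mul2l jL orbT.
rewrite addn1 -[s.+1]addn0; apply: us.
  rewrite leq_add2l leq_mul2l ij orbT /=; apply: leq_trans cK.
  by rewrite leq_add2l leq_mul2l jL orbT.
by rewrite subnDl -mulnBr expnS dvdn_mul.
Qed.

(** Conversely the gain can be spent in a division by [p], after removal of the
    constant term. *)
Lemma smooth_quot K u : sm 1 K u -> sm 0 K (fun j => (u j - u 0%N) / p%:R).
Proof.
move=> [ui us]; split=> [j jK|s i j ij pij].
  have := us 0%N 0%N j; rewrite add0n expn1 expn0 dvd1n; exact.
rewrite addn0.
have -> : ((u j - u 0%N) / p%:R - (u i - u 0%N) / p%:R) / (p ^ s)%:R =
   (u j - u i) / (p ^ (s + 1))%:R.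
  by rewrite addn1 expnS natrM; field; rewrite pr_neq0 pX_neq0.
exact: us.
Qed.

Local Notation digit := (dwork_digit p).

(** The quotient of the coefficient of index [v + p j] for [x] by that of index
    [j] for the Dwork transform of [x]. *)
Definition step_ratio (x : rat) (v j : nat) : rat :=
  poch_unit p x (v + p * j) / poch_unit p 1 (v + p * j) *
  (if (digit x < v)%N then p%:R * (dwork p x + j%:R) else 1).

Lemma pochhammer_fact k : k`!%:R = pochhammer 1 k :> rat.
Proof.
rewrite fact_prod natr_prod big_add1 big_mkord /pochhammer.
by apply: eq_bigr => i _; rewrite nat1r.
Qed.

(** The parameter [1] of the denominator is its own transform.  Numerator and
    denominator contain equally many factors divisible by [p], except that the
    numerator has one more when the digit of [x] is less than [v]. *)
Lemma poch_ratio_split x v j : (v < p)%N ->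
  poch_ratio x (v + p * j) = poch_ratio (dwork p x) j * step_ratio x v j.
Proof.
move=> vp; rewrite /poch_ratio !pochhammer_fact /pochhammer.
rewrite (@big_digit _ p_pr _ _ _ x (fun y => y)) // (@big_digit _ p_pr _ _ _ 1 (fun y => y)) //.
have pv : (p.-1 < v)%N = false by lia.
rewrite !dwork1 // digit1 // pv /= mulr1.
rewrite !big_split /= !prodr_const card_ord /step_ratio /poch_unit digit1 //.
have f0 : \prod_(l < j) (1 + (l : nat)%:R : rat) != 0.
  by apply/prodf_neq0 => l _; rewrite nat1r pnatr_eq0.
set A := \prod_(i < _ | _) _; set C := \prod_(i < j) _.
set B := \prod_(i < _ | _) _; set D := \prod_(i < j) _ in f0 *.
have pj0 : p%:R ^+ j != 0 :> rat by rewrite expf_neq0.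
have [->|B0] := eqVneq B 0; first by rewrite mul0r invr0 !(mul0r, mulr0).
by set E := (if _ then _ else _); field; rewrite B0 f0 pj0.
Qed.

(** A change of [j] by [p ^ s] multiplies numerator and denominator by the same
    product of residues modulo [p ^ (s + 1)]. *)
Lemma step_ratio_smooth x v K : x \in Zl -> sm 1 K (step_ratio x v).
Proof.
move=> xi; have oi : 1 \in Zl := rpred1 _.
rewrite /step_ratio; apply: smoothM; last first.
  case: (digit x < v)%N; last exact: smooth_cst.
  split=> [j _|s i j /andP[ij _] pij].
    by rewrite rpredM ?rpredD ?Zloc_nat // dwork_Zloc.
  have -> : (p%:R * (dwork p x + j%:R) - p%:R * (dwork p x + i%:R)) /
     (p ^ (s + 1))%:R = (j - i)%:R / (p ^ s)%:R.
    by rewrite natrB // addn1 expnS natrM; field; rewrite pr_neq0 pX_neq0.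
  by rewrite (Zloc_nat_div p_pr).
have ri N : poch_unit p x N / poch_unit p 1 N \in Zl.
  by rewrite rpredM //; [have [] := poch_unit_Zloc N xi | have [] := poch_unit_Zloc N oi].
split=> [j _|s i j /andP[ij _] /dvdnP[t tE]]; first exact: ri.
have -> : j = (i + t * p ^ s)%N by lia.
rewrite addn1; elim: t {j ij tE} => [|t IH].
  by rewrite addn0 subrr mul0r rpred0.
pose rho N := poch_unit p x N / poch_unit p 1 N.
rewrite -/(rho _) -/(rho _) in IH *; set N := (v + p * (i + t * p ^ s))%N in IH.
have -> : (v + p * (i + t.+1 * p ^ s) = N + p ^ s.+1)%N.
  by rewrite /N mulSn expnS; lia.
have -> : (rho (N + p ^ s.+1)%N - rho (v + p * i)%N) / (p ^ s.+1)%:R =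
  (rho (N + p ^ s.+1)%N - rho N) / (p ^ s.+1)%:R +
  (rho N - rho (v + p * i)%N) / (p ^ s.+1)%:R by ring.
apply: rpredD => //; have [Om hOm] := poch_unit_period p_pr s.
have h1 := hOm _ N xi; have h2 := hOm _ N oi; rewrite /rho.
have d1 := poch_unit_neq0 N oi; have d2 := poch_unit_neq0 (N + p ^ s.+1) oi.
have [a1 a2] := poch_unit_Zloc N oi; have [a3 a4] := poch_unit_Zloc (N + p ^ s.+1) oi.
have [b1 b2] := poch_unit_Zloc N xi.
set a := poch_unit p x N in h1 b1 *; set a' := poch_unit p x _ in h1 *.
set b := poch_unit p 1 N in h2 d1 a1 a2 *; set b' := poch_unit p 1 _ in h2 d2 a3 a4 *.
set M := (p ^ s.+1)%:R in h1 h2 *.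
have M0 : M != 0 by apply: pX_neq0.
have -> : (a' / b' - a / b) / M =
  (((a' - a * Om) / M) * b - ((b' - b * Om) / M) * a) * (b'^-1 * b^-1).
  by field; rewrite d1 d2 M0.
by apply: rpredM; [apply: rpredB; apply: rpredM | apply: rpredM].
Qed.

(** The inverses of the [x + i] prime to [p] are integral, the other ones are
    the [1 / (p (x' + l))]. *)
Lemma log_ratio_split x v j : x \in Zl -> (v < p)%N ->
  log_ratio x (v + p * j) - log_ratio (dwork p x) j / p%:R -
   (if (digit x < v)%N then (p%:R * (dwork p x + j%:R))^-1 else 0) \in Zl.
Proof.
move=> xi vp; rewrite /log_ratio !sumrB.
rewrite (@big_digit _ p_pr _ _ _ x (fun y => y^-1)) //.
rewrite (@big_digit _ p_pr _ _ _ 1 (fun y => y^-1)) //.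
have pv : (p.-1 < v)%N = false by lia.
rewrite !dwork1 // digit1 // pv /= addr0.
under [\sum_(l < j) (p%:R * (dwork p x + _))^-1]eq_bigr do rewrite invfM.
under [\sum_(l < j) (p%:R * (1 + _))^-1]eq_bigr do rewrite invfM.
rewrite -!mulr_sumr.
set E := (if _ then _ else _); set A := \sum_(i < _ | _) _.
set C := \sum_(i < j) (dwork p x + _)^-1; set D := \sum_(i < j) (1 + _)^-1.
set B := \sum_(i < _ | _) _.
have -> : A + (p%:R^-1 * C + E) - (B + p%:R^-1 * D) - (C - D) / p%:R - E = A - B.
  by ring.
have oi : 1 \in Zl := rpred1 _.
by rewrite /A /B -(digit1 p_pr) rpredB // rpred_sum // => i hi;
  [have [] := nondigit_unit xi hi | have [] := nondigit_unit oi hi].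
Qed.

(** By induction along the division of [k] by [p]. *)
Lemma poch_ratio_Zloc x k : x \in Zl -> poch_ratio x k \in Zl.
Proof.
elim/ltn_ind: k x => k IH x xi; have [->|k0] := posnP k.
  by rewrite /poch_ratio /pochhammer big_ord0 fact0 divr1 rpred1.
rewrite (divn_eq k p) addnC mulnC poch_ratio_split ?ltn_mod // rpredM //.
  by rewrite IH ?dwork_Zloc // ltn_Pdiv // prime_gt1.
by have [+ _] := step_ratio_smooth (k %% p) (k %/ p) xi; apply.
Qed.

Section Family.

Variable n : nat.
Implicit Types a : 'I_n -> rat.

Definition fam_coef a (k : nat) : rat := \prod_(l < n) poch_ratio (a l) k.
Definition fam_log a (k : nat) : rat := \sum_(l < n) log_ratio (a l) k.
Definition fam_step a (v j : nat) : rat := \prod_(l < n) step_ratio (a l) v j.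
Definition fam_dwork a : 'I_n -> rat := fun l => dwork p (a l).

Definition Zfam a := forall l, a l \in Zl.

Lemma fam_dwork_Zloc a : Zfam a -> Zfam (fam_dwork a).
Proof. by move=> ai l; apply: dwork_Zloc. Qed.

Lemma fam_coef_split a v j : (v < p)%N ->
  fam_coef a (v + p * j) = fam_coef (fam_dwork a) j * fam_step a v j.
Proof.
move=> vp; rewrite -big_split; apply: eq_bigr => l _; exact: poch_ratio_split.
Qed.

Lemma fam_coef_Zloc a k : Zfam a -> fam_coef a k \in Zl.
Proof. by move=> ai; apply: rpred_prod => l _; apply: poch_ratio_Zloc. Qed.

Lemma fam_step_smooth a v K : Zfam a -> sm 1 K (fam_step a v).
Proof. by move=> ai; apply: smooth_prod => l _; apply: step_ratio_smooth. Qed.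

(** The possible pole of the logarithmic term at [x' + j] is cancelled by the
    factor [p (x' + j)] of [step_ratio]. *)
Lemma fam_log_split a v j : Zfam a -> (v < p)%N ->
  fam_coef a (v + p * j) *
    (fam_log a (v + p * j) - fam_log (fam_dwork a) j / p%:R) \in Zl.
Proof.
move=> ai vp; rewrite /fam_log mulr_suml -sumrB mulr_sumr.
apply: rpred_sum => l _.
have := log_ratio_split j (ai l) vp.
set E := (if _ then _ else _); set L := log_ratio _ _ - _ => h.
have -> : L = (L - E) + E by ring.
rewrite mulrDr; apply: rpredD.
  by apply: rpredM h; apply: fam_coef_Zloc.
rewrite fam_coef_split // -mulrA; apply: rpredM.
  exact/fam_coef_Zloc/fam_dwork_Zloc.
rewrite /fam_step (bigD1 l) //= mulrAC rpredM //; last first.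
  apply: rpred_prod => m _.
  by have [+ _] := step_ratio_smooth v j (ai m); apply.
rewrite /step_ratio /E; case: ifP => _; last by rewrite mulr0 rpred0.
rewrite -[X in X \in _]mulrA; apply: rpredM.
  have [h1 _] := poch_unit_Zloc (v + p * j) (ai l).
  have [_ h2] := poch_unit_Zloc (v + p * j) (rpred1 Zl).
  exact: rpredM h1 h2.
set y := p%:R * _; have [->|y0] := eqVneq y 0; first by rewrite mul0r rpred0.
by rewrite divff // rpred1.
Qed.

End Family.

End Smooth.

(** * The congruence of Dwork for G / F *)

Lemma big_rev_ord (R : Type) (idx : R) (op : Monoid.com_law idx) K (g : nat -> R) :
  \big[op/idx]_(j < K.+1) g j = \big[op/idx]_(j < K.+1) g (K - j)%N.
Proof. by rewrite (reindex_inj rev_ord_inj). Qed.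

(** In the class of [c] there are [(K - c) / p + 1] indices if [c <= K]. *)
Lemma big_split_mod (R : Type) (idx : R) (op : Monoid.com_law idx) p K
    (g : nat -> R) : (0 < p)%N ->
  \big[op/idx]_(j < K.+1) g j =
  \big[op/idx]_(c < p | (c <= K)%N)
     \big[op/idx]_(j < ((K - c) %/ p).+1) g (c + p * j)%N.
Proof.
move=> p0; pose r (j : 'I_K.+1) := Ordinal (ltn_pmod j p0).
rewrite (partition_big r xpredT) //= [in RHS]big_mkcond /=; apply: eq_bigr => c _.
rewrite (eq_bigl (fun j : 'I_K.+1 => (j %% p == c)%N)) //.
pose L := if (c <= K)%N then ((K - c) %/ p).+1 else 0%N.
rewrite (@big_residue_class _ _ _ p c L) //; first by rewrite /L; case: ifP; rewrite ?big_ord0.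
move=> l; rewrite /L; case: (leqP c K) => cK; last by rewrite ltn0; apply/esym/negbTE; lia.
by rewrite !ltnS leq_divRL //; lia.
Qed.

Section LogBalance.

Variables (p : nat) (p_pr : prime p) (n : nat).
Local Notation Zl := (Zloc p_pr).
Local Notation sm := (smooth p_pr).
Let p_gt0 : (0 < p)%N := prime_gt0 p_pr.
Let pr_neq0 : p%:R != 0 :> rat.
Proof. by rewrite pnatr_eq0 -lt0n. Qed.
Implicit Types a : 'I_n -> rat.

(** Induction on [K] along the division by [p].  For [j = c + p j'] the involution
    [j -> K - j] exchanges the classes of [c] and of [r c], the residue of [K - c],
    and acts on the quotients as [j' -> k c - j'].  Up to integral terms the class
    of [c] gives [1 / p] times a sum of the same form for the transformed
    parameters, with [k c] instead of [K]; its weight [X] is a constant plus [p]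
    times a 1-Lipschitz function, and only its differences occur. *)
Theorem log_balance a K u : Zfam p_pr a -> sm 0 K u ->
  \sum_(j < K.+1) fam_log a j * fam_coef a j * fam_coef a (K - j) *
     (u j - u (K - j)%N) \in Zl.
Proof.
elim/ltn_ind: K a u => K IH a u ai us.
have [->|K0] := posnP K; first by rewrite big_ord1 subrr mulr0 rpred0.
pose a' := fam_dwork p a; have a'i : Zfam p_pr a' by apply: fam_dwork_Zloc.
pose k c := ((K - c) %/ p)%N; pose r c := ((K - c) %% p)%N.
have KE c : (c <= K)%N -> (K = c + r c + p * k c)%N.
  by move=> cK; have := divn_eq (K - c) p; rewrite -/(k c) -/(r c); lia.
have rp c : (r c < p)%N by rewrite ltn_mod.
have revE c j : (c <= K)%N -> (j <= k c)%N ->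
    (K - (c + p * j) = r c + p * (k c - j))%N.
  move=> cK jk; have le : (p * j <= p * k c)%N by rewrite leq_mul2l jk orbT.
  by have := KE c cK; rewrite mulnBr; lia.
(* [X] and [Y] are the parts of the class of [c] that carry [u j] and
   [u (K - j)]; the sum of [Y] over one class is a sum of [X] over the other. *)
pose h c j := fam_log a' j * fam_coef a' j * fam_coef a' (k c - j).
pose W c j := fam_step p a c j * fam_step p a (r c) (k c - j).
pose X c j := W c j * u (c + p * j)%N.
pose Y c j := W c j * u (K - (c + p * j))%N.
pose g j := fam_log a j * fam_coef a j * fam_coef a (K - j) * (u j - u (K - j)%N).
rewrite (@big_split_mod _ _ _ p K g) //=.
pose T c j := p%:R^-1 * (h c j * (X c j - Y c j)).
(* Modulo integral terms only the main part [H'(j) / p] of [H] counts. *)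
have gT c j : (c < p)%N -> (c <= K)%N -> (j <= k c)%N ->
    g (c + p * j)%N - T c j \in Zl.
  move=> cp cK jk; rewrite /g /T; set N := (c + p * j)%N.
  have NK : (N <= K)%N by rewrite /N [K in (_ <= K)%N](KE c cK) -addnA leq_add2l
    (leq_trans _ (leq_addl _ _)) // leq_mul2l jk orbT.
  have e1 : fam_coef a N = fam_coef a' j * fam_step p a c j by apply: fam_coef_split.
  have e2 : fam_coef a (K - N) = fam_coef a' (k c - j) * fam_step p a (r c) (k c - j).
    by rewrite /N revE //; apply: fam_coef_split.
  have -> : fam_log a N * fam_coef a N * fam_coef a (K - N) * (u N - u (K - N)%N) -
      p%:R^-1 * (h c j * (X c j - Y c j)) =
    (fam_coef a N * (fam_log a N - fam_log a' j / p%:R)) * fam_coef a (K - N) *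
      (u N - u (K - N)%N).
    by rewrite /h /X /Y /W -/N e1 e2; ring.
  case: us => ui _; apply: rpredM; last by rewrite rpredB ?ui ?leq_subr.
  apply: rpredM; last exact: fam_coef_Zloc.
  exact: fam_log_split.
suff hT : \sum_(c < p | (c <= K)%N) \sum_(j < (k c).+1) T c j \in Zl.
  rewrite -[X in X \in _](subrK (\sum_(c < p | (c <= K)%N) \sum_(j < (k c).+1) T c j)).
  rewrite -sumrB rpredD // rpred_sum // => c cK; rewrite -sumrB rpred_sum // => j _.
  by rewrite gT // -ltnS.
have rK c : (r c <= K)%N by rewrite (leq_trans (leq_mod _ _)) ?leq_subr.
have rr c : (c < p)%N -> (c <= K)%N -> r (r c) = c /\ k (r c) = k c.
  move=> cp cK; have e : (K - r c = k c * p + c)%N by have := KE c cK; lia.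
  by rewrite /r /k -/(r c) e modnMDl divnMDl // modn_small // divn_small // addn0.
have swap : \sum_(c < p | (c <= K)%N) \sum_(j < (k c).+1) h c j * Y c j =
            \sum_(c < p | (c <= K)%N) \sum_(j < (k c).+1) h c j * X c (k c - j)%N.
  pose rho (c : 'I_p) := Ordinal (rp c).
  rewrite (reindex_onto rho rho) /=; last first.
    by move=> c cK; apply: val_inj => /=; have [-> _] := rr c (ltn_ord c) cK.
  apply: eq_big => [c|c].
    rewrite rK /=; apply/eqP/idP => [<-/=|cK]; first exact: rK.
    by apply: val_inj => /=; have [-> _] := rr c (ltn_ord c) cK.
  move=> /andP[_ /eqP ce].
  have cK : (c <= K)%N by rewrite -ce /=; apply: rK.
  have [e1 e2] := rr c (ltn_ord c) cK.
  rewrite e2; apply: eq_bigr => j _; have jk : (j <= k c)%N by rewrite -ltnS.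
  rewrite /h /Y /X /W e1 e2 subKn // revE ?rK ?e2 // e1.
  by ring.
have -> : \sum_(c < p | (c <= K)%N) \sum_(j < (k c).+1) T c j =
   \sum_(c < p | (c <= K)%N) \sum_(j < (k c).+1) h c j *
      ((X c j - X c 0%N) / p%:R - (X c (k c - j)%N - X c 0%N) / p%:R).
  transitivity (p%:R^-1 * (\sum_(c < p | (c <= K)%N) \sum_(j < (k c).+1) h c j * X c j
     - \sum_(c < p | (c <= K)%N) \sum_(j < (k c).+1) h c j * Y c j)).
    rewrite -sumrB mulr_sumr; apply: eq_bigr => c _.
    by rewrite -sumrB mulr_sumr; apply: eq_bigr => j _; rewrite /T; ring.
  rewrite swap -sumrB mulr_sumr; apply: eq_bigr => c _.
  by rewrite -sumrB mulr_sumr; apply: eq_bigr => j _; ring.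
apply: rpred_sum => c cK; apply: (IH (k c) _ a' (fun j => (X c j - X c 0%N) / p%:R)) => //.
  rewrite /k; have [->|] := posnP (K - c); first by rewrite div0n.
  by move=> h0; rewrite (leq_trans (ltn_Pdiv (prime_gt1 p_pr) h0)) ?leq_subr.
apply: smooth_quot; apply: smoothM; last first.
  by apply: smooth_comp us; have := KE c cK; lia.
apply: smoothM; first exact: fam_step_smooth.
by apply: smooth_rev; apply: fam_step_smooth.
Qed.

Definition famF a : fps := fam_coef a.
Definition famG a : fps := fun k => fam_coef a k * fam_log a k.

(** In degree [v + p K] both products are sums over [j <= K].  Their difference is
    a combination of the integral terms of [fam_log_split] and of [p] times a sum of
    [log_balance] for [u = (w - w 0) / p], after reversal of one of the two sums. *)
Theorem dwork_log a : Zfam p_pr a ->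
  pfps p_pr (phi p (famF (fam_dwork p a)) * (famG a *+ p)
    - phi p (famG (fam_dwork p a)) * famF a).
Proof.
move=> ai N; set a' := fam_dwork p a.
have a'i : Zfam p_pr a' by apply: fam_dwork_Zloc.
pose v := (N %% p)%N; pose K := (N %/ p)%N.
have vp : (v < p)%N by rewrite ltn_mod.
have NE : (N = v + p * K)%N by rewrite /v /K {1}(divn_eq N p); lia.
rewrite fpsB !phi_mulE // -/K.
have subE j : (j <= K)%N -> (N - p * j = v + p * (K - j))%N.
  by move=> jK; rewrite NE mulnBr addnBA // leq_mul2l jK orbT.
pose w := fam_step p a v.
have [wi _] := fam_step_smooth v K ai.
pose S := \sum_(j < K.+1) fam_log a' j * fam_coef a' j * fam_coef a' (K - j) *
   ((w j - w 0%N) / p%:R - (w (K - j)%N - w 0%N) / p%:R).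
have Si : S \in Zl.
  apply: (@log_balance a' K (fun j => (w j - w 0%N) / p%:R)) => //.
  by apply: smooth_quot; apply: fam_step_smooth.
(* [E] is the error of replacing [p H(v + p i)] by [H'(i)]. *)
pose E j := fam_coef a' j * (fam_coef a (v + p * (K - j)) *
   (fam_log a (v + p * (K - j)) - fam_log a' (K - j) / p%:R)).
have -> : (\sum_(j < K.+1) famF a' j * (famG a *+ p) (N - p * j)%N -
    \sum_(j < K.+1) famG a' j * famF a (N - p * j)%N) / p%:R =
   \sum_(j < K.+1) E j + S.
  have SE : S = p%:R^-1 * (\sum_(j < K.+1) fam_log a' (K - j) * fam_coef a' (K - j) *
      fam_coef a' j * w (K - j)%N -
     \sum_(j < K.+1) fam_log a' j * fam_coef a' j * fam_coef a' (K - j) * w (K - j)%N).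
    have -> : \sum_(j < K.+1) fam_log a' (K - j) * fam_coef a' (K - j) *
      fam_coef a' j * w (K - j)%N =
      \sum_(j < K.+1) fam_log a' j * fam_coef a' j * fam_coef a' (K - j) * w j.
      rewrite [RHS](@big_rev_ord _ _ _ K (fun j => fam_log a' j * fam_coef a' j *
         fam_coef a' (K - j) * w j)).
      by apply: eq_bigr => j _; rewrite subKn // -ltnS.
    by rewrite -sumrB mulr_sumr; apply: eq_bigr => j _; ring.
  rewrite SE -!sumrB mulr_sumr -big_split mulr_suml; apply: eq_bigr => j _ /=.
  have jK : (j <= K)%N by rewrite -ltnS.
  rewrite fpsMn subE // /famF /famG /E -mulr_natr.
  have -> : fam_coef a (v + p * (K - j)) = fam_coef a' (K - j) * w (K - j)%N.
    by rewrite fam_coef_split.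
  by field.
rewrite rpredD // rpred_sum // => j _; apply: rpredM; first exact: fam_coef_Zloc.
exact: fam_log_split.
Qed.

End LogBalance.

(** * The series log (q / z) and p-integrality of the mirror map *)

(** The series [log (q / z)]. *)
Definition logq n (a : n.-tuple rat) : fps := hypG a * fps_inv (hypF a).

Section Bridge.

Variables (n : nat) (a : n.-tuple rat).

Lemma hyp_coefE k : hyp_coef a k = fam_coef (tnth a) k.
Proof. by rewrite /fam_coef /hyp_coef prodf_div prodr_const card_ord. Qed.

Lemma hypFE : hypF a = famF (tnth a).
Proof. by apply: fpsP => k; apply: hyp_coefE. Qed.

Lemma hypGE : hypG a = famG (tnth a).
Proof. by apply: fpsP => k; rewrite /hypG hyp_coefE. Qed.

Lemma hypF0 : hypF a 0%N = 1.
Proof.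
rewrite hypFE /famF /fam_coef big1 // => l _.
by rewrite /poch_ratio /pochhammer big_ord0 fact0 divr1.
Qed.

Lemma hypG0 : hypG a 0%N = 0.
Proof. by rewrite /hypG big1 ?mulr0 // => j _; rewrite big_ord0. Qed.

Lemma logq0 : logq a 0%N = 0.
Proof. by rewrite /logq fpsM0 hypG0 mul0r. Qed.

Lemma logqK : logq a * hypF a = hypG a.
Proof.
by rewrite /logq -mulrA [fps_inv _ * _]mulrC fps_mulV ?mulr1 // hypF0.
Qed.

Lemma mirror_mapE : mirror_map a = fps_mulX (fps_exp (logq a)).
Proof. by []. Qed.

End Bridge.

Lemma logq_perm n (a b : n.-tuple rat) : perm_eq a b -> logq a = logq b.
Proof.
move=> ab; have cE k : hyp_coef a k = hyp_coef b k.
  rewrite !hyp_coefE /fam_coef -!(big_tuple _ _ _ xpredT (fun x => poch_ratio x k)).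
  exact: perm_big.
have FE : hypF a = hypF b by apply: fpsP => k; apply: cE.
have GE : hypG a = hypG b.
  apply: fpsP => k; rewrite /hypG cE; congr (_ * _).
  rewrite -!(big_tuple _ _ _ xpredT (fun x => log_ratio x k)).
  exact: perm_big.
by rewrite /logq FE GE.
Qed.

Section IntegralParameters.

Variables (p : nat) (p_pr : prime p) (n : nat) (a : n.-tuple rat).
Local Notation Zl := (Zloc p_pr).
Local Notation Zf := (Zfps p_pr).
Let p_gt0 : (0 < p)%N := prime_gt0 p_pr.

Lemma p_integral_mulX f : p_integral p (fps_mulX f) <-> f \in Zf.
Proof.
split=> [h|/ZfpsP h [|k]]; last exact: h; first by apply/ZfpsP => k; apply: (h k.+1).
by rewrite -(ZlocE p_pr) rpred0.
Qed.

Hypothesis a_int : forall i, tnth a i \in Zl.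

Lemma hypF_Zfps : hypF a \in Zf.
Proof. by apply/ZfpsP => k; rewrite hypFE; apply: fam_coef_Zloc. Qed.

Lemma dwork_tuple_int i : tnth (map_tuple (dwork p) a) i \in Zl.
Proof. by rewrite tnth_map; apply: dwork_Zloc. Qed.

End IntegralParameters.

Section MirrorCriterion.

Variables (p : nat) (p_pr : prime p) (n : nat) (a : n.-tuple rat).
Local Notation Zl := (Zloc p_pr).
Local Notation Zf := (Zfps p_pr).
Let p_gt0 : (0 < p)%N := prime_gt0 p_pr.
Hypothesis a_int : forall i, tnth a i \in Zl.
Let a' := map_tuple (dwork p) a.

Lemma logq_dwork : pfps p_pr (logq a *+ p - phi p (logq a')).
Proof.
have a'i : forall i, tnth a' i \in Zl by apply: dwork_tuple_int.
have FE : famF (fam_dwork p (tnth a)) = hypF a'.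
  rewrite hypFE; apply: fpsP => k; apply: eq_bigr => l _.
  by rewrite /fam_dwork tnth_map.
have GE : famG (fam_dwork p (tnth a)) = hypG a'.
  rewrite hypGE; apply: fpsP => k; rewrite -[RHS]/(famF _ k * _) -hypFE -FE.
  congr (_ * _); apply: eq_bigr => l _.
  by rewrite /fam_dwork tnth_map.
have := dwork_log (a := tnth a) a_int; rewrite FE GE -hypFE -hypGE => h.
have vF := fps_mulV (hypF0 a).
have vF' : phi p (hypF a') * fps_inv (phi p (hypF a')) = 1.
  by rewrite fps_mulV // phi0 hypF0.
have -> : logq a *+ p - phi p (logq a') =
   (fps_inv (phi p (hypF a')) * fps_inv (hypF a)) *
   (phi p (hypF a') * (hypG a *+ p) - phi p (hypG a') * hypF a).
  rewrite -(logqK a') phiM // -[hypG a]logqK.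
  set F := hypF a in vF *; set P := phi p (hypF a') in vF' *.
  set I := fps_inv F in vF *; set J := fps_inv P in vF' *.
  transitivity ((P * J) * (F * I) * (logq a *+ p - phi p (logq a'))); last by ring.
  by rewrite vF vF' !mul1r.
apply: pfpsMl h; apply: rpredM; apply: Zfps_inv; last exact: hypF_Zfps.
by apply: Zfps_phi; apply: hypF_Zfps.
Qed.

(** By the lemma of Dieudonne and Dwork and the congruence above, which
    allows [f_a'(z ^ p)] in place of [p f_a(z)]. *)
Theorem mirror_criterion :
  p_integral p (mirror_map a) <-> pfps p_pr (logq a' - logq a).
Proof.
rewrite mirror_mapE (p_integral_mulX p_pr) dieudonne_dwork ?logq0 //.
have hD := logq_dwork.
have e : phi p (logq a' - logq a) = phi p (logq a') - phi p (logq a).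
  exact: raddfB.
have e1 : logq a *+ p - phi p (logq a) =
  (logq a *+ p - phi p (logq a')) + phi p (logq a' - logq a) by rewrite e; ring.
have e2 : phi p (logq a' - logq a) =
  (logq a *+ p - phi p (logq a)) - (logq a *+ p - phi p (logq a')) by rewrite e; ring.
split=> h.
  have {}h : pfps p_pr (phi p (logq a' - logq a)).
    by rewrite e2; apply: pfpsD h (pfpsN hD).
  by move=> k; have := h (p * k)%N; rewrite /phi dvdn_mulr // mulKn.
rewrite e1; apply: pfpsD hD _ => k; rewrite /phi; case: ifP => _; first exact: h.
by rewrite mul0r rpred0.
Qed.

End MirrorCriterion.

(** * Reflection of the parameters of a Gauss series *)

Lemma poch_ratioS x k :
  k.+1%:R * poch_ratio x k.+1 = (x + k%:R) * poch_ratio x k.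
Proof.
rewrite /poch_ratio /pochhammer big_ord_recr /= factS natrM.
have k0 : k.+1%:R != 0 :> rat by rewrite pnatr_eq0.
have f0 : k`!%:R != 0 :> rat by rewrite pnatr_eq0 -lt0n fact_gt0.
by field; rewrite f0 ?nat1r ?natr1 k0.
Qed.

Lemma log_ratioS x k :
  log_ratio x k.+1 = log_ratio x k + ((x + k%:R)^-1 - k.+1%:R^-1).
Proof. by rewrite /log_ratio big_ord_recr /= nat1r. Qed.

Local Notation zz := (mono 1 1).
Local Notation cst c := (mono c 0).

Lemma cstME c (f : fps) k : (cst c * f) k = c * f k.
Proof. by rewrite mono_mulE subn0. Qed.
Lemma zME (f : fps) k : (zz * f) k = if k is j.+1 then f j else 0.
Proof. by rewrite mono_mulE; case: k => // k; rewrite mul1r subn1. Qed.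
Lemma theta_z : theta zz = zz.
Proof.
apply: fpsP => k; rewrite /theta /mono; case: eqP => [->|]; by rewrite ?mulr0 // mulr1.
Qed.
Lemma theta_cst c : theta (cst c) = 0.
Proof.
by apply: fpsP => k; rewrite /theta /mono; case: eqP => [->|]; rewrite ?mulr0 ?mul0r.
Qed.
Lemma cstB c d : cst (c - d) = cst c - cst d.
Proof. by apply: fpsP => k; rewrite fpsB /mono; case: eqP; rewrite ?subr0. Qed.
Lemma cstD c d : cst (c + d) = cst c + cst d.
Proof. by apply: fpsP => k; rewrite fpsD /mono; case: eqP; rewrite ?addr0. Qed.
Lemma cst1 : cst 1 = 1.
Proof. by apply: fpsP => k; rewrite fps1 /mono; case: eqP. Qed.

Section Gauss.

Variables (x y : rat) (x0 : 0 < x) (y0 : 0 < y).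
Let s := cst (x + y).
Let d := cst (x * y).
Definition gaussF : fps := fun k => poch_ratio x k * poch_ratio y k.
Definition gaussG : fps := fun k => gaussF k * (log_ratio x k + log_ratio y k).
Let F := gaussF.
Let G := gaussG.

Lemma gaussFS k : k.+1%:R ^+ 2 * F k.+1 = (x + k%:R) * (y + k%:R) * F k.
Proof.
by rewrite /F /gaussF expr2 mulrACA !poch_ratioS; ring.
Qed.

Lemma gaussF_ode :
  (1 - zz) * theta (theta F) = s * (zz * theta F) + d * (zz * F).
Proof.
apply: fpsP => k; rewrite mulrBl mul1r fpsB fpsD !cstME !zME /theta.
case: k => [|k]; first by rewrite !(mul0r, mulr0, subr0, addr0).
by rewrite mulrA -expr2 gaussFS; ring.
Qed.

(** Obtained by applying the hypergeometric operator to [F log z + G]. *)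
Lemma gaussG_ode :
  (1 - zz) * theta (theta G) =
  s * (zz * theta G) + d * (zz * G) - (1 - zz) * theta F *+ 2 + s * (zz * F).
Proof.
apply: fpsP => k; rewrite !mulrBl !mul1r !(fpsB, fpsD, fpsMn) !cstME !zME /theta.
case: k => [|k].
  by rewrite !(mul0r, mulr0, subr0, addr0, mul0rn).
rewrite mulrA -expr2 /G /gaussG -/F !log_ratioS.
have k0 : k.+1%:R != 0 :> rat by rewrite pnatr_eq0.
have xk : x + k%:R != 0 by rewrite gt_eqF // ltr_wpDr // ler0n.
have yk : y + k%:R != 0 by rewrite gt_eqF // ltr_wpDr // ler0n.
have -> : F k.+1 = (x + k%:R) * (y + k%:R) * F k / k.+1%:R ^+ 2.
  by rewrite -gaussFS mulrC mulKf ?expf_neq0.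
rewrite !mulr2n; field.
by rewrite xk yk ?nat1r ?natr1 k0.
Qed.

(** The Wronskian of the solutions [F] and [F log z + G] for [z d/dz]; the
    logarithms cancel. *)
Definition wronskian : fps := F * F + F * theta G - G * theta F.

(** As for every second order equation, the Wronskian satisfies a first order
    equation; here it is [(1 - z) ^ (- (x + y))]. *)
Lemma wronskian_ode : (1 - zz) * theta wronskian = s * (zz * wronskian).
Proof.
rewrite /wronskian raddfB raddfD /= !thetaM.
have eF := gaussF_ode; have eG := gaussG_ode.
set F1 := theta F in eF eG *; set F2 := theta F1 in eF *.
set G1 := theta G in eG *; set G2 := theta G1 in eG *.
transitivity ((1 - zz) * F * F1 *+ 2 + F * ((1 - zz) * G2) - G * ((1 - zz) * F2)).
  by ring.
by rewrite eF eG; ring.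
Qed.

End Gauss.

Lemma gauss_uniq (s d : rat) (X Y : fps) : X 0%N = Y 0%N ->
  (1 - zz) * theta (theta X) = cst s * (zz * theta X) + cst d * (zz * X) ->
  (1 - zz) * theta (theta Y) = cst s * (zz * theta Y) + cst d * (zz * Y) -> X = Y.
Proof.
move=> XY eX eY; apply: fpsP; elim=> // k IH.
have H (U : fps) : (1 - zz) * theta (theta U) =
   cst s * (zz * theta U) + cst d * (zz * U) ->
   U k.+1 = (k%:R * k%:R + s * k%:R + d) * U k / k.+1%:R ^+ 2.
  move=> /(congr1 (fun f : fps => f k.+1)).
  rewrite mulrBl mul1r fpsB fpsD !cstME !zME /theta => e.
  have k0 : k.+1%:R ^+ 2 != 0 :> rat by rewrite expf_neq0 // pnatr_eq0.
  by apply: (mulIf k0); rewrite mulfVK //; rewrite expr2; lra.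
by rewrite (H X eX) (H Y eY) IH.
Qed.

Lemma first_order_uniq (c : fps) (X Y : fps) : X 0%N = Y 0%N ->
  (1 - zz) * theta X = c * (zz * X) -> (1 - zz) * theta Y = c * (zz * Y) -> X = Y.
Proof.
move=> XY eX eY; pose V := fps_inv (1 - zz).
have VK : (1 - zz) * V = 1 by rewrite fps_mulV // fpsB fps1 /mono subr0.
have H (U : fps) : (1 - zz) * theta U = c * (zz * U) -> theta U = U * (c * zz * V).
  move=> e; rewrite -[LHS]mul1r -VK; transitivity (V * ((1 - zz) * theta U)).
    by ring.
  by rewrite e; ring.
apply: (@theta_uniq (c * zz * V)) (H _ eX) (H _ eY) => //.
by rewrite !fpsM0 /mono mulr0 mul0r.
Qed.

(** The series [Y] is [(1 - z) ^ (s - 1)]. *)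
Lemma poch_ratio_ode s : let Y := poch_ratio (1 - s) : fps in
  (1 - zz) * theta Y = (1 - cst s) * (zz * Y).
Proof.
move=> Y; rewrite -cst1 -cstB cst1; apply: fpsP => k.
rewrite mulrBl mul1r fpsB !cstME !zME /theta; case: k => [|k].
  by rewrite !(mul0r, mulr0, subr0).
by rewrite poch_ratioS -/Y; ring.
Qed.

(** Euler's transformation [F(1-x, 1-y) = (1 - z) ^ (x + y - 1) F(x, y)]: both
    sides satisfy the same differential equation. *)
Lemma gauss_euler x y :
  gaussF (1 - x) (1 - y) = (poch_ratio (1 - (x + y)) : fps) * gaussF x y.
Proof.
pose Y : fps := poch_ratio (1 - (x + y)); rewrite -/Y.
pose F := gaussF x y; rewrite -/F.
have p0 u : poch_ratio u 0 = 1.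
  by rewrite /poch_ratio /pochhammer big_ord0 fact0 divr1.
pose s := cst (x + y).
have eY : (1 - zz) * theta Y = (1 - s) * (zz * Y) := poch_ratio_ode _.
have eY2 : (1 - zz) * theta (theta Y) =
    (1 - s) * (zz * Y) + (2%:R - s) * (zz * theta Y).
  have := congr1 theta eY; rewrite thetaM [in RHS]thetaM [in RHS]thetaM.
  rewrite !raddfB /= theta1 theta_z theta_cst => e.
  transitivity ((0 - zz) * theta Y + (1 - zz) * theta (theta Y) + zz * theta Y).
    by ring.
  by rewrite e; ring.
have eF := gaussF_ode x y; rewrite -/F -/s in eF.
apply: (@gauss_uniq ((1 - x) + (1 - y)) ((1 - x) * (1 - y))).
- by rewrite fpsM0 /F /gaussF /Y !p0 !mulr1.
- exact: gaussF_ode.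
have -> : (1 - x) + (1 - y) = (1 + 1) - (x + y) by ring.
have -> : (1 - x) * (1 - y) = 1 - (x + y) + x * y by ring.
rewrite (cstB (1 + 1)) (cstD 1 1) (cstD _ (x * y)) (cstB 1) !cst1 -/s.
rewrite thetaM raddfD /= !thetaM.
set Y1 := theta Y in eY eY2 *; set Y2 := theta Y1 in eY2 *.
set F1 := theta F in eF *; set F2 := theta F1 in eF *.
transitivity (F * ((1 - zz) * Y2) + F1 * ((1 - zz) * Y1) *+ 2 + Y * ((1 - zz) * F2)).
  by ring.
by rewrite eY eY2 eF; ring.
Qed.

Lemma hypF_gauss (a : 2.-tuple rat) :
  hypF a = gaussF (tnth a ord0) (tnth a (lift ord0 ord0)).
Proof.
by rewrite hypFE; apply: fpsP => k; rewrite /famF /fam_coef !big_ord_recl big_ord0 mulr1.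
Qed.

Lemma hypG_gauss (a : 2.-tuple rat) :
  hypG a = gaussG (tnth a ord0) (tnth a (lift ord0 ord0)).
Proof.
apply: fpsP => k; rewrite -[LHS]/(hypF a k * _) hypF_gauss; congr (_ * _).
by rewrite !big_ord_recl big_ord0 addr0.
Qed.

Lemma wronskian_logq (a : 2.-tuple rat) :
  wronskian (tnth a ord0) (tnth a (lift ord0 ord0)) =
  hypF a * hypF a * (1 + theta (logq a)).
Proof.
rewrite /wronskian -hypF_gauss -hypG_gauss -(logqK a) thetaM.
by set F := hypF a; ring.
Qed.

(** The Wronskian is [F ^ 2 (1 + theta f)].  Under the reflection both it and
    [F ^ 2] are multiplied by the same power of [1 - z], so that [theta f] does not
    change. *)
Theorem logq_reflection (a : 2.-tuple rat) : (forall i, 0 < tnth a i < 1) ->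
  logq (map_tuple (fun x => 1 - x) a) = logq a.
Proof.
move=> ha; set b := map_tuple _ a.
set x := tnth a ord0; set y := tnth a (lift ord0 ord0).
have /andP[x0 x1] : 0 < x < 1 by apply: ha.
have /andP[y0 y1] : 0 < y < 1 by apply: ha.
have bx : tnth b ord0 = 1 - x by rewrite tnth_map.
have by_ : tnth b (lift ord0 ord0) = 1 - y by rewrite tnth_map.
pose Y : fps := poch_ratio (1 - (x + y)).
have bF : hypF b = Y * hypF a by rewrite !hypF_gauss bx by_ gauss_euler.
have Y0 : Y 0%N = 1.
  by rewrite /Y /poch_ratio /pochhammer big_ord0 fact0 divr1.
have e1 := wronskian_ode x0 y0.
have e2 : (1 - zz) * theta (wronskian (1 - x) (1 - y)) =
    (2%:R - cst (x + y)) * (zz * wronskian (1 - x) (1 - y)).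
  rewrite wronskian_ode ?subr_gt0 //; congr (_ * _).
  have -> : (1 - x) + (1 - y) = (1 + 1) - (x + y) by ring.
  by rewrite cstB (cstD 1 1) cst1.
have eY := poch_ratio_ode (x + y); rewrite -/Y in eY.
have WE : wronskian (1 - x) (1 - y) = Y * Y * wronskian x y.
  apply: first_order_uniq e2 _.
    rewrite -bx -by_ !wronskian_logq !fpsM0 bF fpsM0 !fpsD !theta0 !Y0; ring.
  rewrite !thetaM; set s := cst _ in e1 eY *; set W := wronskian x y in e1 *.
  transitivity (Y * W * ((1 - zz) * theta Y) *+ 2 + Y * Y * ((1 - zz) * theta W)).
    by ring.
  by rewrite e1 eY; ring.
move: WE; rewrite -bx -by_ !wronskian_logq bF => WE.
pose U := Y * hypF a; have U0 : U 0%N = 1 by rewrite /U fpsM0 Y0 hypF0 mulr1.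
have UV := fps_mulV U0; set V := fps_inv U in UV.
have tE : theta (logq b) = theta (logq a).
  apply: (addrI 1); transitivity (U * V * (U * V) * (1 + theta (logq b))).
    by rewrite UV !mul1r.
  transitivity (V * V * (U * U * (1 + theta (logq b)))); first by ring.
  rewrite [U * U * _]WE.
  transitivity (U * V * (U * V) * (1 + theta (logq a))); first by rewrite /U; ring.
  by rewrite UV !mul1r.
apply: fpsP => -[|k]; first by rewrite !logq0.
apply: (@mulfI _ (k.+1%:R : rat)); first by rewrite pnatr_eq0.
exact: (congr1 (fun f : fps => f k.+1) tE).
Qed.

(** * Integrality of the mirror map *)

Lemma good_prime_Zloc n (a : n.-tuple rat) p (p_pr : prime p) :
  good_prime a p -> forall i, tnth a i \in Zloc p_pr.
Proof. by case. Qed.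

Theorem dwork_cond_p_integral n (a : n.-tuple rat) p :
  (forall i, 0 < tnth a i < 1) -> good_prime a p -> dwork_cond a p ->
  p_integral p (mirror_map a).
Proof.
move=> ha gp; have [p_pr _] := gp; have ai := good_prime_Zloc p_pr gp.
move=> hC; apply/(mirror_criterion (p_pr := p_pr) ai).
suff -> : logq (map_tuple (dwork p) a) = logq a.
  by move=> k; rewrite subrr fps0 mul0r rpred0.
move: hC; rewrite /dwork_cond; case: eqP => [n2|_]; last exact: logq_perm.
subst n => -[] h; first exact: logq_perm.
by rewrite -[RHS]logq_reflection //; apply: logq_perm.
Qed.

Section Dilate.

Variable c : rat.
Local Notation dil := (fps_dilate c).

Lemma dilateM f g : dil (f * g) = dil f * dil g.
Proof.
apply: fpsP => k; rewrite /fps_dilate !fpsM mulr_sumr; apply: eq_bigr => i _.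
have ik : (i <= k)%N by rewrite -ltnS.
by rewrite -{1}(subnKC ik) exprD; ring.
Qed.

Lemma dilate1 : dil 1 = 1.
Proof. by apply: fpsP => -[|k]; rewrite /fps_dilate fps1 ?expr0 ?mulr1 ?mulr0. Qed.

Lemma dilateX f m : dil (f ^+ m) = dil f ^+ m.
Proof. by elim: m => [|m IH]; rewrite ?expr0 ?dilate1 // !exprS dilateM IH. Qed.

Lemma dilate0 f : dil f 0%N = f 0%N.
Proof. by rewrite /fps_dilate expr0 mul1r. Qed.

Lemma dilate_exp f : dil (fps_exp f) = fps_exp (dil f).
Proof.
apply: fpsP => k; rewrite {1}/fps_dilate /fps_exp mulr_sumr; apply: eq_bigr => m _.
by rewrite !fps_powE -dilateX mulrA.
Qed.

Lemma dilate_inv f : f 0%N = 1 -> dil (fps_inv f) = fps_inv (dil f).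
Proof.
move=> f0; have d0 : dil f 0%N = 1 by rewrite dilate0.
rewrite -[LHS]mulr1 -(fps_mulV d0) mulrA -dilateM [fps_inv f * f]mulrC fps_mulV //.
by rewrite dilate1 mul1r.
Qed.

End Dilate.

Section BadPrime.

Variables (p : nat) (p_pr : prime p) (D : nat).
Local Notation Zl := (Zloc p_pr).
Local Notation Zf := (Zfps p_pr).
Hypothesis pD : (p %| D)%N.
Let p_gt0 : (0 < p)%N := prime_gt0 p_pr.
Let pr_neq0 : p%:R != 0 :> rat.
Proof. by rewrite pnatr_eq0 -lt0n. Qed.

Lemma powfact_Zloc k : p%:R ^+ k / k`!%:R \in Zl.
Proof.
have [->|k0] := posnP k; first by rewrite expr0 fact0 divr1 rpred1.
by rewrite -(prednK k0) exprS -mulrA rpredM ?Zloc_nat //= prednK // Zloc_expfact.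
Qed.

Lemma den_powfact_Zloc k : D%:R ^+ k / k`!%:R \in Zl.
Proof.
have /dvdnP[q ->] := pD; rewrite natrM exprMn -mulrA.
by apply: rpredM; [rewrite rpredX ?Zloc_nat | apply: powfact_Zloc].
Qed.

(** The harmonic terms [1 / (1 + i)] with [i < k] have at most the poles of
    [1 / k!]. *)
Lemma den_pow_inv_Zloc i k : (i < k)%N -> D%:R ^+ k * (1 + i%:R)^-1 \in Zl.
Proof.
move=> ik; rewrite nat1r -(subnK ik) exprD -mulrA.
apply: rpredM; first by rewrite rpredX ?Zloc_nat.
have f0 : i`!%:R != 0 :> rat by rewrite pnatr_eq0 -lt0n fact_gt0.
have i0 : i.+1%:R != 0 :> rat by rewrite pnatr_eq0.
have -> : D%:R ^+ i.+1 * (i.+1%:R)^-1 = D%:R ^+ i.+1 / i.+1`!%:R * i`!%:R :> rat.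
  by rewrite factS natrM invfM mulrA mulfVK.
by apply: rpredM; [apply: den_powfact_Zloc | apply: Zloc_nat].
Qed.

Section Param.

Variables (x : rat) (xD : D%:R * x \is a Num.int).

Lemma den_poch_Zloc k : D%:R ^+ k * pochhammer x k \in Zl.
Proof.
rewrite /pochhammer -[k in D%:R ^+ k]card_ord -prodr_const -big_split /=.
apply: rpred_prod => i _; rewrite mulrDr -natrM.
by rewrite rpredD ?Zloc_nat // Zloc_int.
Qed.

Lemma den_poch_ratio_Zloc k : (D%:R ^+ 2) ^+ k * poch_ratio x k \in Zl.
Proof.
have -> : (D%:R ^+ 2) ^+ k * poch_ratio x k =
   (D%:R ^+ k * pochhammer x k) * (D%:R ^+ k / k`!%:R).
  by rewrite expr2 exprMn /poch_ratio; ring.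
by apply: rpredM; [apply: den_poch_Zloc | apply: den_powfact_Zloc].
Qed.

(** Here [x + i] is one of the factors of the Pochhammer symbol. *)
Lemma den_poch_ratio_div_Zloc k i : (i < k)%N ->
  (D%:R ^+ 2) ^+ k * poch_ratio x k * (x + i%:R)^-1 \in Zl.
Proof.
move=> ik.
have -> : (D%:R ^+ 2) ^+ k * poch_ratio x k * (x + i%:R)^-1 =
   (D%:R ^+ k * pochhammer x k * (x + i%:R)^-1) * (D%:R ^+ k / k`!%:R).
  by rewrite expr2 exprMn /poch_ratio; ring.
apply: rpredM; last exact: den_powfact_Zloc.
rewrite /pochhammer -[k in D%:R ^+ k]card_ord -prodr_const -big_split /=.
rewrite (bigD1 (Ordinal ik)) //= [X in X \in _]mulrAC; apply: rpredM; last first.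
  apply: rpred_prod => j _; rewrite mulrDr -natrM.
  by rewrite rpredD ?Zloc_nat // Zloc_int.
have [->|x0] := eqVneq (x + i%:R) 0; first by rewrite mulr0 mul0r rpred0.
by rewrite mulfK ?Zloc_nat.
Qed.

End Param.

Variables (n : nat) (a : n.-tuple rat).
Hypothesis aD : forall i, D%:R * tnth a i \is a Num.int.

Let A k (P : pred 'I_n) := \prod_(l < n | P l) ((D%:R ^+ 2) ^+ k * poch_ratio (tnth a l) k).

Let A_Zloc k P : A k P \in Zl.
Proof. by apply: rpred_prod => l _; apply: den_poch_ratio_Zloc. Qed.

Let AE k : (D%:R ^+ (2 * n)) ^+ k * hyp_coef a k = A k xpredT.
Proof.
rewrite /A big_split /= prodr_const card_ord hyp_coefE /fam_coef.
by rewrite exprM -!exprM; congr (_ ^+ _ * _); lia.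
Qed.

Lemma dilate_hypF_Zfps : fps_dilate (D%:R ^+ (2 * n).+1) (hypF a) \in Zf.
Proof.
apply/ZfpsP => k; rewrite /fps_dilate exprS exprMn -mulrA AE.
by apply: rpredM; [rewrite rpredX ?rpredX ?Zloc_nat | apply: A_Zloc].
Qed.

Lemma dilate_hypG_Zfps : fps_dilate (D%:R ^+ (2 * n).+1) (hypG a) \in Zf.
Proof.
apply/ZfpsP => k; rewrite /fps_dilate /hypG exprS exprMn mulrA -[X in X * _]mulrA AE.
rewrite mulr_sumr; apply: rpred_sum => l _; rewrite mulr_sumr; apply: rpred_sum => i _.
rewrite mulrBr; apply: rpredB; last first.
  rewrite [X in X \in _]mulrAC; apply: rpredM; last exact: A_Zloc.
  exact: den_pow_inv_Zloc.
rewrite -mulrA; apply: rpredM; first by rewrite rpredX ?Zloc_nat.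
rewrite /A (bigD1 l) //= [X in X \in _]mulrAC; apply: rpredM; last exact: A_Zloc.
exact: den_poch_ratio_div_Zloc.
Qed.

(** One factor [D] more than for [F] and [G] makes [G / F] divisible by [p],
    so that its exponential is integral. *)
Lemma dilate_mirror_bad k :
  fps_dilate (D ^ (2 * n).+2)%:R (mirror_map a) k \in Zl.
Proof.
rewrite mirror_mapE; case: k => [|k]; first by rewrite /fps_dilate /= mulr0 rpred0.
rewrite /fps_dilate /= exprS -mulrA; apply: rpredM; first exact: Zloc_nat.
set N := _%:R; rewrite -[_ * _]/(fps_dilate N (fps_exp (logq a)) k).
apply/ZfpsP: k; rewrite dilate_exp.
pose E : rat := D%:R ^+ (2 * n).+1.
have fE : fps_dilate E (logq a) \in Zf.
  rewrite /logq dilateM dilate_inv ?hypF0 //; apply: rpredM.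
    exact: dilate_hypG_Zfps.
  exact/Zfps_inv/dilate_hypF_Zfps.
set h := fps_dilate N _.
have h0 : h 0%N = 0 by rewrite /h dilate0 logq0.
have hp : pfps p_pr h.
  move=> [|k]; first by rewrite h0 mul0r rpred0.
  have -> : h k.+1 = D%:R ^+ k.+1 * fps_dilate E (logq a) k.+1.
    by rewrite /h /fps_dilate mulrA -exprMn /N natrX exprS.
  have /dvdnP[q qD] := pD.
  have DE : D%:R = q%:R * p%:R :> rat by rewrite qD natrM.
  set y := fps_dilate E _ _.
  have -> : D%:R ^+ k.+1 * y / p%:R = q%:R * D%:R ^+ k * y.
    by rewrite exprS {1}DE; field.
  apply: rpredM; last by apply/ZfpsP.
  by apply: rpredM; rewrite ?rpredX ?Zloc_nat.
have /pfpsP[R Ri RE] := exp_pfps h0 hp.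
have -> : fps_exp h = 1 + R *+ p by rewrite -RE addrC subrK.
by rewrite rpredD ?rpred1 // rpredMn.
Qed.

End BadPrime.

(** * Denominators and invariance of log (q / z) *)

Lemma int_of_p_integral x :
  (forall p, prime p -> p_integral_rat p x) -> x \is a Num.int.
Proof.
move=> h; rewrite Qint_def; have [le1|gt1] := leqP `|denq x| 1.
  by rewrite eq_le -[denq x]gez0_abs ?denq_ge0 // lez_nat le1 /= lez_nat absz_gt0 denq_neq0.
by have := h _ (pdiv_prime gt1); rewrite /p_integral_rat pdiv_dvd.
Qed.

Definition common_den n (a : n.-tuple rat) : nat :=
  \prod_(i < n) `|denq (tnth a i)|%N.

Lemma common_den_gt0 n (a : n.-tuple rat) : (0 < common_den a)%N.
Proof. by apply: prodn_gt0 => i; rewrite absz_gt0 denq_neq0. Qed.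

Lemma common_denP n (a : n.-tuple rat) i :
  (common_den a)%:R * tnth a i \is a Num.int.
Proof.
rewrite /common_den (bigD1 i) //= mulnC natrM -mulrA rpredM ?natr_int //.
by rewrite pmulrn absz_denq mulrC -numqE intr_int.
Qed.

Lemma common_den_good n (a : n.-tuple rat) p : prime p ->
  ~~ (p %| common_den a)%N -> good_prime a p.
Proof.
move=> p_pr pd; split=> // i; apply: contra pd => h.
by rewrite /common_den (bigD1 i) //= dvdn_mulr.
Qed.

Lemma good_common_den n (a : n.-tuple rat) p : good_prime a p ->
  ~~ (p %| common_den a)%N.
Proof.
move=> [p_pr h]; rewrite /common_den.
elim/big_rec: _ => [|i m _ IH]; first by rewrite dvdn1 neq_ltn prime_gt1 // orbT.
by rewrite Euclid_dvdM // negb_or IH andbT; apply: h.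
Qed.

Theorem dwork_cond_N_integral n (a : n.-tuple rat) :
  (forall i, 0 < tnth a i < 1) ->
  (forall p, good_prime a p -> dwork_cond a p) -> N_integral (mirror_map a).
Proof.
move=> ha hC; pose D := common_den a; have D0 : (0 < D)%N := common_den_gt0 a.
exists (D ^ (2 * n).+2)%N; first by rewrite expn_gt0 D0.
move=> k; apply: int_of_p_integral => p p_pr; rewrite -(ZlocE p_pr).
have [pD|pD] := boolP (p %| D)%N.
  by apply: dilate_mirror_bad => // i; apply: common_denP.
have gp := common_den_good p_pr pD; rewrite /fps_dilate.
apply: rpredM; first by rewrite rpredX ?Zloc_nat.
exact: (dwork_cond_p_integral ha gp (hC p gp)).
Qed.

Section Necessity.

Variables (n d : nat) (d0 : (0 < d)%N).
Implicit Types r s : {ffun 'I_n -> 'I_d}.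

Definition frac_tuple r : n.-tuple rat := [tuple (r i : nat)%:R / d%:R | i < n].
Local Notation ft := frac_tuple.

(** Two different series among finitely many differ in some coefficient, and only
    finitely many primes divide the numerator of that difference. *)
Lemma logq_separation : exists2 M : nat, (0 < M)%N &
  forall r s p (p_pr : prime p), ~~ (p %| M)%N ->
    pfps p_pr (logq (ft r) - logq (ft s)) -> logq (ft r) = logq (ft s).
Proof.
have h (rs : {ffun 'I_n -> 'I_d} * {ffun 'I_n -> 'I_d}) :
  exists M, (0 < M)%N /\ forall p (p_pr : prime p), ~~ (p %| M)%N ->
    pfps p_pr (logq (ft rs.1) - logq (ft rs.2)) -> logq (ft rs.1) = logq (ft rs.2).
  have [e|ne] := boolp.pselect (logq (ft rs.1) = logq (ft rs.2)).
    by exists 1%N.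
  have [k hk] : exists k, (logq (ft rs.1) - logq (ft rs.2)) k != 0.
    apply: boolp.contrapT => no; apply: ne; apply: fpsP => k; apply/eqP.
    rewrite -subr_eq0; apply: boolp.contrapT => /negP hk; apply: no.
    by exists k.
  set x := (logq _ - logq _) k in hk; exists `|numq x|%N.
  rewrite absz_gt0 numq_eq0; split=> // p p_pr pM /(_ k); rewrite -/x => xp.
  case/negP: pM; have : (numq x)%:~R / (p ^ 1)%:R \in Zloc p_pr.
    rewrite expn1 numqE mulrAC; apply: rpredM xp _.
    by apply: Zloc_int; rewrite intr_int.
  by rewrite Zloc_int_div expn1 dvdzE absz_nat.
have [M hM] := fin_all_exists h.
exists (\prod_rs M rs)%N; first by apply: prodn_gt0 => rs; case: (hM rs).
move=> r s p p_pr pM; have [_ H] := hM (r, s); apply: H.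
by apply: contra pM => pM; rewrite (bigD1 (r, s)) //= dvdn_mulr.
Qed.

Definition positive r := forall i, (0 < r i)%N.

(** On fractions with denominator [d] in the interval from 0 to 1 the Dwork
    transform is the division by [p] modulo [d]. *)
Lemma dwork_frac p (x : nat) : prime p -> ~~ (p %| d)%N -> (0 < x < d)%N ->
  exists x' : nat, [/\ (0 < x' < d)%N, dwork p (x%:R / d%:R) = x'%:R / d%:R
    & (d%:Z %| (p * x')%:Z - x%:Z)%Z].
Proof.
move=> p_pr pd /andP[x0 xd]; set y := x%:R / d%:R.
have p0 := prime_gt0 p_pr.
have pr0 : p%:R != 0 :> rat by rewrite pnatr_eq0 -lt0n.
have dr0 : d%:R != 0 :> rat by rewrite pnatr_eq0 -lt0n.
have yi : y \in Zloc p_pr by apply: rpredM; [apply: Zloc_nat | apply: Zloc_inv_nat].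
have yi' := dwork_Zloc yi; pose e := dwork_digit p y.
have ep : (e < p)%N by apply: digit_lt.
have E : dwork p y * d%:R = (x + d * e)%:R / p%:R.
  by rewrite /dwork -/e /y natrD natrM; field; rewrite dr0 pr0.
have : (x + d * e)%:R / (p ^ 1)%:R \in Zloc p_pr.
  by rewrite expn1 -E; apply: rpredM yi' (Zloc_nat _ _).
rewrite Zloc_nat_div expn1 => /dvdnP[x' xE]; exists x'; split.
- have : (0 < x' * p < d * p)%N by rewrite -xE; apply/andP; split; nia.
  by rewrite ltn_pmul2r // => /andP[]; case: (x').
- by apply: (mulIf dr0); rewrite E xE natrM mulfK // mulfVK.
- apply/dvdzP; exists e%:Z; lia.
Qed.

Lemma dwork_frac_tuple r p : prime p -> ~~ (p %| d)%N -> positive r ->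
  exists r', [/\ positive r', map_tuple (dwork p) (ft r) = ft r' &
      forall i, (d%:Z %| (p * r' i)%:Z - (r i : nat)%:Z)%Z].
Proof.
move=> p_pr pd r0.
have h i : exists x' : 'I_d, [/\ (0 < x')%N,
    dwork p ((r i : nat)%:R / d%:R) = (x' : nat)%:R / d%:R
    & (d%:Z %| (p * x')%:Z - (r i : nat)%:Z)%Z].
  have rd : (0 < r i < d)%N by rewrite r0 ltn_ord.
  have [x' [/andP[x0 xd] e1 e2]] := dwork_frac p_pr pd rd.
  by exists (Ordinal xd).
have [f hf] := fin_all_exists h; exists [ffun i => f i]; split=> [i||i].
- by rewrite ffunE; case: (hf i).
- by apply: eq_from_tnth => i; rewrite tnth_map !tnth_mktuple ffunE; case: (hf i).
- by rewrite ffunE; case: (hf i).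
Qed.

Lemma reflect_frac_tuple r : positive r -> exists r', [/\ positive r',
  map_tuple (fun x => 1 - x) (ft r) = ft r' &
  forall i, (r' i : nat) = (d - r i)%N].
Proof.
move=> r0; have h i : (d - r i < d)%N by rewrite ltn_subrL r0 d0.
exists [ffun i => Ordinal (h i)]; split=> [i||i]; last by rewrite ffunE.
  by rewrite ffunE /= subn_gt0.
apply: eq_from_tnth => i; rewrite tnth_map !tnth_mktuple ffunE /=.
have dr0 : d%:R != 0 :> rat by rewrite pnatr_eq0 -lt0n.
by rewrite natrB; [field | exact/ltnW/ltn_ord].
Qed.

Variables (N M : nat) (N0 : (0 < N)%N) (M0 : (0 < M)%N).
Hypothesis hM : forall r s p (p_pr : prime p), ~~ (p %| M)%N ->
    pfps p_pr (logq (ft r) - logq (ft s)) -> logq (ft r) = logq (ft s).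

Definition almost_integral r :=
  forall p, prime p -> ~~ (p %| N)%N -> p_integral p (mirror_map (ft r)).

Lemma logq_dwork_invariant r r' p : prime p -> ~~ (p %| N * M * d)%N ->
  almost_integral r -> map_tuple (dwork p) (ft r) = ft r' ->
  logq (ft r') = logq (ft r).
Proof.
move=> p_pr; rewrite !Euclid_dvdM // !negb_or => /andP[/andP[pN pM] pd] ri e.
apply: (hM (p_pr := p_pr)) => //; rewrite -e.
apply/mirror_criterion; last exact: ri.
move=> i; rewrite tnth_mktuple; apply: rpredM; first exact: Zloc_nat.
exact: Zloc_inv_nat.
Qed.

Lemma almost_integral_logq r r' : logq (ft r') = logq (ft r) ->
  almost_integral r -> almost_integral r'.
Proof. by move=> e ri p p_pr pN; rewrite mirror_mapE e -mirror_mapE; apply: ri. Qed.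

(** By induction on the prime factors of [u]: each of them divides neither [N]
    nor [M], hence relates the series of [r] and of its Dwork transform. *)
Lemma logq_unit_invariant u r s : (0 < u)%N -> coprime u (N * M * d) -> positive r ->
  almost_integral r -> (forall i, (d%:Z %| (u * s i)%:Z - (r i : nat)%:Z)%Z) ->
  logq (ft s) = logq (ft r).
Proof.
elim/ltn_ind: u r => u IH r u0 cu r0 ri h.
have [u1|u1] := leqP u 1.
  have {u1}u1 : u = 1%N by lia.
  suff -> : s = r by []. 
  apply/ffunP => i; apply: val_inj => /=; have := h i; rewrite u1 mul1n.
  rewrite -eqz_mod_dvd !modz_nat eqz_nat !modn_small ?ltn_ord //.
  by move/eqP.
pose p := pdiv u; have p_pr : prime p := pdiv_prime u1.
have /dvdnP[u' uE] := pdiv_dvd u; rewrite -/p in uE.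
have pNMd : ~~ (p %| N * M * d)%N.
  rewrite -prime_coprime //; apply: coprime_dvdl cu; exact: pdiv_dvd.
have pd : coprimez d%:Z p%:Z.
  rewrite coprimezE !absz_nat coprime_sym prime_coprime //.
  by apply: contra pNMd; apply: dvdn_mull.
have pd' : ~~ (p %| d)%N by apply: contra pNMd; apply: dvdn_mull.
have [r' [r'0 eb hr']] := dwork_frac_tuple p_pr pd' r0.
have e := logq_dwork_invariant p_pr pNMd ri eb.
rewrite -e; apply: (IH u') => //.
- by rewrite uE ltn_Pmulr ?prime_gt1 //; case: (u') uE u0 => // ->.
- by case: (u') uE u0 => // ->.
- by apply: coprime_dvdl cu; rewrite uE dvdn_mulr.
- exact: almost_integral_logq ri.
move=> i; rewrite -(Gauss_dvdzl _ pd).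
have -> : ((u' * s i)%:Z - (r' i : nat)%:Z) * p%:Z =
  ((u * s i)%:Z - (r i : nat)%:Z) - ((p * r' i)%:Z - (r i : nat)%:Z).
  by rewrite uE !PoszM; ring.
by rewrite rpredB.
Qed.

(** [2 N M d - 1] represents [-1] and is prime to [N M d]. *)
Lemma logq_reflect_invariant r : positive r -> almost_integral r ->
  logq (map_tuple (fun x => 1 - x) (ft r)) = logq (ft r).
Proof.
move=> r0 ri; have [r' [_ -> hr']] := reflect_frac_tuple r0.
pose Q := (N * M * d)%N; have Q0 : (0 < Q)%N by rewrite !muln_gt0 N0 M0.
apply: (@logq_unit_invariant (2 * Q).-1) => //; first by lia.
  apply: (@coprime_dvdr _ (2 * Q)); first exact: dvdn_mull.
  by apply: coprimePn; rewrite muln_gt0.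
move=> i; have rd := ltn_ord (r i); rewrite hr'.
apply/dvdzP; exists (2 * (N * M)%:Z * (d - r i)%:Z - 1).
have -> : ((2 * Q).-1 * (d - r i))%:Z = (2 * Q%:Z - 1) * (d%:Z - (r i : nat)%:Z) by nia.
rewrite /Q PoszM -subzn; [ring | exact: ltnW].
Qed.

(** The prime [p] may divide [N M], but its residue modulo [d] is also represented
    by [d m + p], where [m] is the part of [N M] prime to [p]. *)
Lemma logq_good_invariant r r' p : prime p -> ~~ (p %| d)%N -> positive r ->
  almost_integral r -> map_tuple (dwork p) (ft r) = ft r' ->
  (forall i, (d%:Z %| (p * r' i)%:Z - (r i : nat)%:Z)%Z) ->
  logq (ft r') = logq (ft r).
Proof.
move=> p_pr pd r0 ri e hr'.
have NM0 : (0 < N * M)%N by rewrite muln_gt0 N0.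
have [m pm mE] := pfactor_coprime p_pr NM0.
have pdm : coprime p (d * m) by rewrite coprimeMr prime_coprime // pd.
apply: (@logq_unit_invariant (d * m + p)) => //.
- by rewrite addn_gt0 (prime_gt0 p_pr) orbT.
- rewrite coprimeMr [X in coprime _ X && _]mE !coprimeMr.
  rewrite -andbA; apply/and3P; split.
  + by rewrite coprime_sym /coprime gcdnMDl -/(coprime m p) coprime_sym.
  + by rewrite coprimeXr // coprime_sym /coprime gcdnDr.
  + rewrite coprime_sym /coprime [(d * m)%N]mulnC gcdnMDl -/(coprime d p).
    by rewrite coprime_sym prime_coprime.
move=> i; have -> : ((d * m + p) * r' i)%:Z - (r i : nat)%:Z =
   (m * r' i)%:Z * d%:Z + ((p * r' i)%:Z - (r i : nat)%:Z).
  by rewrite mulnDl PoszD !PoszM; ring.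
by rewrite rpredD // dvdz_mull.
Qed.

End Necessity.

Theorem logq_invariance n (a : n.-tuple rat) : (forall i, 0 < tnth a i < 1) ->
  N_integral (mirror_map a) -> forall p, good_prime a p ->
  let b := map_tuple (dwork p) a in
  [/\ forall i, 0 < tnth b i < 1, logq b = logq a,
      logq (map_tuple (fun x => 1 - x) a) = logq a &
      logq (map_tuple (fun x => 1 - x) b) = logq b].
Proof.
move=> ha [N N0 hN] p gp b; have [p_pr _] := gp.
pose d := common_den a; have d0 : (0 < d)%N := common_den_gt0 a.
have dr0 : d%:R != 0 :> rat by rewrite pnatr_eq0 -lt0n.
have pd : ~~ (p %| d)%N := good_common_den gp.
have h i : exists x : 'I_d, (0 < x)%N /\ tnth a i = (x : nat)%:R / d%:R.
  have /intrP[m mE] := common_denP a i; have /andP[a0 a1] := ha i.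
  have aE : tnth a i = m%:~R / d%:R by rewrite -mE mulrC mulKf.
  have m0 : (0 < m)%R.
    by rewrite -(ltr0z rat) -mE pmulr_rgt0 // ltr0n.
  have md : (m < d%:Z)%R.
    by rewrite -(ltr_int rat) -mE -pmulrn gtr_pMr // ltr0n.
  have xd : (`|m| < d)%N by lia.
  exists (Ordinal xd) => /=; split; first by lia.
  by rewrite aE (pmulrn 1 `|m|%N) gez0_abs // ltW.
have [f hf] := fin_all_exists h; pose r : {ffun 'I_n -> 'I_d} := [ffun i => f i].
have r0 : positive r by move=> i; rewrite ffunE; case: (hf i).
have aE : a = frac_tuple r.
  by apply: eq_from_tnth => i; rewrite tnth_mktuple ffunE; case: (hf i).
(* [M] is divisible by the primes at which a congruence is no equality. *)
have [M M0 hM] := logq_separation n d.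
have ri : almost_integral N r.
  move=> l l_pr lN k; rewrite -aE.
  have N0r : N%:R != 0 :> rat by rewrite pnatr_eq0 -lt0n.
  have -> : mirror_map a k = fps_dilate N%:R (mirror_map a) k * (N%:R^-1) ^+ k.
    by rewrite /fps_dilate exprVn mulrC mulKf ?expf_neq0.
  rewrite -(ZlocE l_pr); apply: rpredM; first exact/Zloc_int/hN.
  by rewrite rpredX // Zloc_inv_nat.
have [r' [r'0 bE hr']] := dwork_frac_tuple d0 p_pr pd r0.
have e : logq (frac_tuple r') = logq (frac_tuple r).
  exact: (logq_good_invariant d0 N0 M0 hM p_pr pd r0 ri bE hr').
have ri' := almost_integral_logq e ri.
rewrite /b aE bE; split=> //.
- move=> i; rewrite tnth_mktuple divr_gt0 ?ltr0n //=.
  by rewrite ltr_pdivrMr ?ltr0n // mul1r ltr_nat ltn_ord.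
- exact: (logq_reflect_invariant d0 N0 M0 hM).
- exact: (logq_reflect_invariant d0 N0 M0 hM).
Qed.

(** * The first coefficients of log (q / z) *)

Section FirstCoefficients.

Variables (n : nat) (a : n.-tuple rat).

Definition par_prod (k : nat) : rat := \prod_(l < n) (tnth a l + k%:R).
(** The derivative of [prod (t + a_l)] at [t = k]. *)
Definition par_deriv (k : nat) : rat :=
  par_prod k * \sum_(l < n) (tnth a l + k%:R)^-1.

Lemma hyp_coefS k :
  hyp_coef a k.+1 = par_prod k * hyp_coef a k / k.+1%:R ^+ n.
Proof.
have k0 : k.+1%:R != 0 :> rat by rewrite pnatr_eq0.
apply: (@mulfI _ (k.+1%:R ^+ n)); first by rewrite expf_neq0.
rewrite [RHS]mulrC mulfVK ?expf_neq0 // !hyp_coefE /fam_coef.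
rewrite -[n in _ ^+ n]card_ord -prodr_const -!big_split /=.
by apply: eq_bigr => l _; rewrite poch_ratioS.
Qed.

(** Logarithmic differentiation of [hyp_coefS]. *)
Lemma hypGS k : hypG a k.+1 =
  (par_prod k * hypG a k + hyp_coef a k * par_deriv k
    - n%:R / k.+1%:R * par_prod k * hyp_coef a k) / k.+1%:R ^+ n.
Proof.
rewrite /hypG hyp_coefS /par_deriv.
have -> : \sum_(j < n) \sum_(i < k.+1) ((tnth a j + i%:R)^-1 - (1 + i%:R)^-1) =
   \sum_(j < n) \sum_(i < k) ((tnth a j + i%:R)^-1 - (1 + i%:R)^-1)
   + (\sum_(l < n) (tnth a l + k%:R)^-1 - n%:R / k.+1%:R).
  have -> : n%:R / k.+1%:R = \sum_(l < n) (1 + k%:R)^-1 :> rat.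
    by rewrite sumr_const card_ord -[RHS]mulr_natl nat1r.
  rewrite -sumrB -big_split /=; apply: eq_bigr => l _.
  by rewrite big_ord_recr.
have k0 : k.+1%:R ^+ n != 0 :> rat by rewrite expf_neq0 // pnatr_eq0.
by ring.
Qed.

Lemma logq_rec k : logq a k = hypG a k - \sum_(i < k) logq a i * hyp_coef a (k - i).
Proof.
rewrite -[hypG a k]/(hypG a k) -(logqK a) fpsM big_ord_recr /= subnn hypF0 mulr1.
by rewrite addrAC subrr add0r.
Qed.

End FirstCoefficients.

Section Coefs.
Variables (n : nat) (P Q : nat -> rat).
Let N : rat := n%:R.
(** The first coefficients of [F], [G] and [G / F] as functions of the values [P]
    and the slopes [Q] of the polynomial [prod (t + a_l)] at [t = 0, 1, 2]. *)
Definition coefA1 := P 0%N.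
Definition coefA2 := P 1%N * coefA1 / 2%:R ^+ n.
Definition coefG1 := Q 0%N - N * P 0%N.
Definition coefG2 := (P 1%N * coefG1 + coefA1 * Q 1%N - N / 2%:R * P 1%N * coefA1) / 2%:R ^+ n.
Definition coefG3 := (P 2%N * coefG2 + coefA2 * Q 2%N - N / 3%:R * P 2%N * coefA2) / 3%:R ^+ n.
Definition logq1 := coefG1.
Definition logq2 := coefG2 - logq1 * coefA1.
Definition logq3 := coefG3 - logq1 * coefA2 - logq2 * coefA1.
End Coefs.

Section LogqCoefs.
Variables (n : nat) (a : n.-tuple rat).
Local Notation P := (par_prod a).
Local Notation Q := (par_deriv a).

Lemma logq_coefs :
  [/\ logq a 1%N = logq1 n P Q, logq a 2%N = logq2 n P Q & logq a 3%N = logq3 n P Q].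
Proof.
have A0 : hyp_coef a 0 = 1 := hypF0 a.
have G0 := hypG0 a.
have A1 : hyp_coef a 1 = coefA1 P by rewrite hyp_coefS A0 expr1n divr1 mulr1.
have A2 : hyp_coef a 2 = coefA2 n P by rewrite hyp_coefS A1.
have G1 : hypG a 1%N = coefG1 n P Q.
  by rewrite hypGS A0 G0 expr1n /coefG1; field.
have G2 : hypG a 2%N = coefG2 n P Q by rewrite hypGS A1 G1.
have G3 : hypG a 3%N = coefG3 n P Q by rewrite hypGS A2 G2.
have L0 := logq0 a.
have L1 : logq a 1%N = logq1 n P Q.
  by rewrite logq_rec big_ord1 L0 mul0r subr0 G1.
have L2 : logq a 2%N = logq2 n P Q.
  by rewrite logq_rec !big_ord_recl big_ord0 /= L0 mul0r add0r addr0 G2 /bump /= L1 A1.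
split=> //; rewrite logq_rec !big_ord_recl big_ord0 /= L0 mul0r add0r addr0 G3.
by rewrite /bump /= L1 L2 A1 A2 /logq3 opprD addrA.
Qed.

End LogqCoefs.

Section Elementary.

Let h : rat := 2%:R^-1.

(** Values and slopes of the polynomial [s ^ n + c1 s ^ (n - 1) + ...] at
    [s = k + 1/2].  In this coordinate the reflection of the parameters changes the
    sign of [c1] and [c3]. *)
Definition value1 (c1 : rat) (k : nat) : rat := (k%:R + h) + c1.
Definition slope1 (c1 : rat) (k : nat) : rat := 1.
Definition value2 c1 c2 (k : nat) : rat := (k%:R + h) ^+ 2 + c1 * (k%:R + h) + c2.
Definition slope2 c1 (c2 : rat) (k : nat) : rat := 2%:R * (k%:R + h) + c1.
Definition value3 c1 c2 c3 (k : nat) : rat :=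
  (k%:R + h) ^+ 3 + c1 * (k%:R + h) ^+ 2 + c2 * (k%:R + h) + c3.
Definition slope3 c1 c2 (c3 : rat) (k : nat) : rat :=
  3%:R * (k%:R + h) ^+ 2 + 2%:R * c1 * (k%:R + h) + c2.
Definition value4 c1 c2 c3 c4 (k : nat) : rat :=
  (k%:R + h) ^+ 4 + c1 * (k%:R + h) ^+ 3 + c2 * (k%:R + h) ^+ 2 + c3 * (k%:R + h) + c4.
Definition slope4 c1 c2 c3 (c4 : rat) (k : nat) : rat :=
  4%:R * (k%:R + h) ^+ 3 + 3%:R * c1 * (k%:R + h) ^+ 2 + 2%:R * c2 * (k%:R + h) + c3.

Local Ltac unf := rewrite /logq3 /logq2 /logq1 /coefG3 /coefG2 /coefG1 /coefA2 /coefA1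
  /value1 /slope1 /value2 /slope2 /value3 /slope3 /value4 /slope4 /h.

Lemma logq1_two c1 c2 : logq1 2 (value2 c1 c2) (slope2 c1 c2) = 2%:R^-1 - 2%:R * c2.
Proof. by unf; field. Qed.
Lemma logq2_two_diff c1 c1' c2 : logq2 2 (value2 c1 c2) (slope2 c1 c2) -
  logq2 2 (value2 c1' c2) (slope2 c1' c2) = - (c1 ^+ 2 - c1' ^+ 2) / 16%:R.
Proof. by unf; field. Qed.

(** The odd part of the first coefficient expresses [c3] by [c1]; after this
    substitution the odd parts of the next two coefficients are multiples of [c1]
    whose cofactors vanish together only for [c1 = 3/2] or [c1 = -3/2].  Parameters
    strictly between [0] and [1] do not reach these values. *)
Lemma logq1_three_odd c1 c2 c3 : logq1 3 (value3 c1 c2 c3) (slope3 c1 c2 c3) -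
  logq1 3 (value3 (- c1) c2 (- c3)) (slope3 (- c1) c2 (- c3)) = 2%:R^-1 * (c1 - 12%:R * c3).
Proof. by unf; field. Qed.
Lemma logq2_three_odd c1 c2 : let c3 := c1 / 12%:R in
  logq2 3 (value3 c1 c2 c3) (slope3 c1 c2 c3) -
  logq2 3 (value3 (- c1) c2 (- c3)) (slope3 (- c1) c2 (- c3)) =
  c1 * (3%:R - 4%:R * c2) / 32%:R.
Proof. by rewrite /=; unf; field. Qed.
Lemma logq3_three_odd c1 : let c2 := 3%:R / 4%:R in let c3 := c1 / 12%:R in
  logq3 3 (value3 c1 c2 c3) (slope3 c1 c2 c3) -
  logq3 3 (value3 (- c1) c2 (- c3)) (slope3 (- c1) c2 (- c3)) =
  c1 * (9%:R - 4%:R * c1 ^+ 2) / 729%:R.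
Proof. by rewrite /=; unf; field. Qed.
Lemma logq1_three_even c2 : logq1 3 (value3 0 c2 0) (slope3 0 c2 0) = 3%:R / 8%:R - c2 / 2%:R.
Proof. by unf; field. Qed.

(** As for three parameters; the cofactors now vanish together only for
    [c1 = 2] or [c1 = -2]. *)
Lemma logq1_four_odd c1 c2 c3 c4 : logq1 4 (value4 c1 c2 c3 c4) (slope4 c1 c2 c3 c4) -
  logq1 4 (value4 (- c1) c2 (- c3) c4) (slope4 (- c1) c2 (- c3) c4) =
  2%:R^-1 * (c1 - 4%:R * c3).
Proof. by unf; field. Qed.
Lemma logq2_four_odd c1 c2 c4 : let c3 := c1 / 4%:R in
  logq2 4 (value4 c1 c2 c3 c4) (slope4 c1 c2 c3 c4) -
  logq2 4 (value4 (- c1) c2 (- c3) c4) (slope4 (- c1) c2 (- c3) c4) =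
  c1 * (3%:R - 2%:R * c2) / 32%:R.
Proof. by rewrite /=; unf; field. Qed.
Lemma logq3_four_odd c1 c4 : let c2 := 3%:R / 2%:R in let c3 := c1 / 4%:R in
  logq3 4 (value4 c1 c2 c3 c4) (slope4 c1 c2 c3 c4) -
  logq3 4 (value4 (- c1) c2 (- c3) c4) (slope4 (- c1) c2 (- c3) c4) =
  c1 * (4%:R - c1 ^+ 2) / 324%:R.
Proof. by rewrite /=; unf; field. Qed.
Lemma logq1_four_even c2 c4 : logq1 4 (value4 0 c2 0 c4) (slope4 0 c2 0 c4) = 4%:R^-1 - 4%:R * c4.
Proof. by unf; field. Qed.
(** Besides [c2 = c2'] there is a second solution, which is excluded by
    [selfdual4_bounds]. *)
Lemma logq2_four_even_diff c2 c2' c4 : logq2 4 (value4 0 c2 0 c4) (slope4 0 c2 0 c4) -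
  logq2 4 (value4 0 c2' 0 c4) (slope4 0 c2' 0 c4) =
  (c2 - c2') * (80%:R * c4 + 5%:R - 6%:R * (c2 + c2')) / 256%:R.
Proof. by unf; field. Qed.

(** Parameters are written as [1/2] plus a root. *)
Definition centred1 x : 1.-tuple rat := [tuple h + x].
Definition centred2 x y : 2.-tuple rat := [tuple h + x; h + y].
Definition centred3 x y z : 3.-tuple rat := [tuple h + x; h + y; h + z].
Definition centred4 x y z w : 4.-tuple rat := [tuple h + x; h + y; h + z; h + w].

Lemma centred1_ex (a : 1.-tuple rat) : exists x, a = centred1 x.
Proof.
case/tupleP: a => x t; rewrite (tuple0 t); exists (x - h).
by apply: val_inj; rewrite /= subrKC.
Qed.

Lemma centred2_ex (a : 2.-tuple rat) : exists x y, a = centred2 x y.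
Proof.
case/tupleP: a => x a; case/tupleP: a => y t; rewrite (tuple0 t).
by exists (x - h), (y - h); apply: val_inj; rewrite /= !subrKC.
Qed.

Lemma centred3_ex (a : 3.-tuple rat) : exists x y z, a = centred3 x y z.
Proof.
case/tupleP: a => x a; case/tupleP: a => y a; case/tupleP: a => z t.
rewrite (tuple0 t).
by exists (x - h), (y - h), (z - h); apply: val_inj; rewrite /= !subrKC.
Qed.

Lemma centred4_ex (a : 4.-tuple rat) : exists x y z w, a = centred4 x y z w.
Proof.
case/tupleP: a => x a; case/tupleP: a => y a; case/tupleP: a => z a.
case/tupleP: a => w t; rewrite (tuple0 t).
by exists (x - h), (y - h), (z - h), (w - h); apply: val_inj; rewrite /= !subrKC.
Qed.

Let refl1 x : 1 - (h + x) = h - x. Proof. by rewrite /h; field. Qed.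

Lemma centred2_reflect x y : map_tuple (fun t => 1 - t) (centred2 x y) = centred2 (- x) (- y).
Proof. by apply: val_inj; rewrite /= !refl1. Qed.
Lemma centred3_reflect x y z :
  map_tuple (fun t => 1 - t) (centred3 x y z) = centred3 (- x) (- y) (- z).
Proof. by apply: val_inj; rewrite /= !refl1. Qed.
Lemma centred4_reflect x y z w :
  map_tuple (fun t => 1 - t) (centred4 x y z w) = centred4 (- x) (- y) (- z) (- w).
Proof. by apply: val_inj; rewrite /= !refl1. Qed.

Definition in01 n (a : n.-tuple rat) := forall i, 0 < tnth a i < 1.

Lemma in01_mem n (a : n.-tuple rat) t : in01 a -> t \in (a : seq rat) -> 0 < t < 1.
Proof. by move=> ha /tnthP[i ->]. Qed.

Lemma par_centred1 x : in01 (centred1 x) ->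
  par_prod (centred1 x) = value1 x /\ par_deriv (centred1 x) = slope1 x.
Proof.
move=> ha; have /andP[x0 _] := ha ord0; rewrite (tnth_nth 0) /= in x0.
split; apply: boolp.funext => k; rewrite /par_deriv /par_prod !big_ord_recl !big_ord0.
  by rewrite !(tnth_nth 0) /= /value1; ring.
rewrite !(tnth_nth 0) /= /slope1.
have k0 : 0 <= k%:R :> rat by [].
by field; lra.
Qed.

Lemma par_centred2 x y : in01 (centred2 x y) ->
  par_prod (centred2 x y) = value2 (x + y) (x * y) /\
  par_deriv (centred2 x y) = slope2 (x + y) (x * y).
Proof.
move=> ha.
have /andP[x0 _] : 0 < h + x < 1 by apply: (in01_mem ha); rewrite !inE eqxx ?orbT.
have /andP[y0 _] : 0 < h + y < 1 by apply: (in01_mem ha); rewrite !inE eqxx ?orbT.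
split; apply: boolp.funext => k; rewrite /par_deriv /par_prod !big_ord_recl !big_ord0.
  by rewrite !(tnth_nth 0) /= /value2; ring.
rewrite !(tnth_nth 0) /= /slope2.
have k0 : 0 <= k%:R :> rat by [].
by field; apply/andP; split; lra.
Qed.

Lemma par_centred3 x y z : in01 (centred3 x y z) ->
  let c1 := x + y + z in let c2 := x * y + x * z + y * z in let c3 := x * y * z in
  par_prod (centred3 x y z) = value3 c1 c2 c3 /\ par_deriv (centred3 x y z) = slope3 c1 c2 c3.
Proof.
move=> ha c1 c2 c3.
have /andP[x0 _] : 0 < h + x < 1 by apply: (in01_mem ha); rewrite !inE eqxx ?orbT.
have /andP[y0 _] : 0 < h + y < 1 by apply: (in01_mem ha); rewrite !inE eqxx ?orbT.
have /andP[z0 _] : 0 < h + z < 1 by apply: (in01_mem ha); rewrite !inE eqxx ?orbT.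
split; apply: boolp.funext => k; rewrite /par_deriv /par_prod !big_ord_recl !big_ord0.
  by rewrite !(tnth_nth 0) /= /value3 /c1 /c2 /c3; ring.
rewrite !(tnth_nth 0) /= /slope3 /c1 /c2.
have k0 : 0 <= k%:R :> rat by [].
by field; apply/and3P; split; lra.
Qed.

Lemma par_centred4 x y z w : in01 (centred4 x y z w) ->
  let c1 := x + y + z + w in
  let c2 := x * y + x * z + x * w + y * z + y * w + z * w in
  let c3 := x * y * z + x * y * w + x * z * w + y * z * w in
  let c4 := x * y * z * w in
  par_prod (centred4 x y z w) = value4 c1 c2 c3 c4 /\
  par_deriv (centred4 x y z w) = slope4 c1 c2 c3 c4.
Proof.
move=> ha c1 c2 c3 c4.
have /andP[x0 _] : 0 < h + x < 1 by apply: (in01_mem ha); rewrite !inE eqxx ?orbT.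
have /andP[y0 _] : 0 < h + y < 1 by apply: (in01_mem ha); rewrite !inE eqxx ?orbT.
have /andP[z0 _] : 0 < h + z < 1 by apply: (in01_mem ha); rewrite !inE eqxx ?orbT.
have /andP[w0 _] : 0 < h + w < 1 by apply: (in01_mem ha); rewrite !inE eqxx ?orbT.
split; apply: boolp.funext => k; rewrite /par_deriv /par_prod !big_ord_recl !big_ord0.
  by rewrite !(tnth_nth 0) /= /value4 /c1 /c2 /c3 /c4; ring.
rewrite !(tnth_nth 0) /= /slope4 /c1 /c2 /c3.
have k0 : 0 <= k%:R :> rat by [].
by field; apply/and4P; split; lra.
Qed.

End Elementary.

(** * Recovering at most four parameters *)

Section Few.

Let h : rat := 2%:R^-1.

Let bnd n (a : n.-tuple rat) x : in01 a -> h + x \in (a : seq rat) -> - h < x < h.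
Proof. by move=> ha /(in01_mem ha); rewrite /h => H; lra. Qed.

Let H : {poly rat} := 'X - h%:P.

Lemma centred2_perm x y x' y' : x + y = x' + y' -> x * y = x' * y' ->
  perm_eq (centred2 x y) (centred2 x' y').
Proof.
have E u v : \prod_(t <- centred2 u v) ('X - t%:P) =
    H ^+ 2 - (u + v)%:P * H + (u * v)%:P.
  by rewrite !big_cons big_nil -/h !(rmorphD, rmorphM) /= /H; ring.
by move=> e1 e2; apply: prod_XsubC_eq; rewrite !E e1 e2.
Qed.

Lemma centred3_perm x y z x' y' z' : x + y + z = x' + y' + z' ->
  x * y + x * z + y * z = x' * y' + x' * z' + y' * z' ->
  x * y * z = x' * y' * z' -> perm_eq (centred3 x y z) (centred3 x' y' z').
Proof.
have E u v w : \prod_(t <- centred3 u v w) ('X - t%:P) =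
    H ^+ 3 - (u + v + w)%:P * H ^+ 2 + (u * v + u * w + v * w)%:P * H
    - (u * v * w)%:P.
  by rewrite !big_cons big_nil -/h !(rmorphD, rmorphM) /= /H; ring.
by move=> e1 e2 e3; apply: prod_XsubC_eq; rewrite !E e1 e2 e3.
Qed.

Lemma centred4_perm x y z w x' y' z' w' : x + y + z + w = x' + y' + z' + w' ->
  x * y + x * z + x * w + y * z + y * w + z * w =
    x' * y' + x' * z' + x' * w' + y' * z' + y' * w' + z' * w' ->
  x * y * z + x * y * w + x * z * w + y * z * w =
    x' * y' * z' + x' * y' * w' + x' * z' * w' + y' * z' * w' ->
  x * y * z * w = x' * y' * z' * w' -> perm_eq (centred4 x y z w) (centred4 x' y' z' w').
Proof.
have E u v s t : \prod_(i <- centred4 u v s t) ('X - i%:P) =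
    H ^+ 4 - (u + v + s + t)%:P * H ^+ 3
    + (u * v + u * s + u * t + v * s + v * t + s * t)%:P * H ^+ 2
    - (u * v * s + u * v * t + u * s * t + v * s * t)%:P * H
    + (u * v * s * t)%:P.
  by rewrite !big_cons big_nil -/h !(rmorphD, rmorphM) /= /H; ring.
by move=> e1 e2 e3 e4; apply: prod_XsubC_eq; rewrite !E e1 e2 e3 e4.
Qed.

Lemma logq_inj1 (a b : 1.-tuple rat) : in01 a -> in01 b -> logq a = logq b ->
  perm_eq a b.
Proof.
have [x ->] := centred1_ex a; have [y ->] := centred1_ex b => ha hb e.
have [+ _ _] := logq_coefs (centred1 x); have [+ _ _] := logq_coefs (centred1 y).
have [-> ->] := par_centred1 ha; have [-> ->] := par_centred1 hb; rewrite e => ->.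
rewrite /logq1 /coefG1 /value1 /slope1 => e1; have -> : x = y by lra.
exact: perm_refl.
Qed.

Lemma in01_reflect n (a : n.-tuple rat) : in01 a -> in01 (map_tuple (fun x => 1 - x) a).
Proof. by move=> ha i; rewrite tnth_map; have := ha i; lra. Qed.

Lemma logq_inj2 (a b : 2.-tuple rat) : in01 a -> in01 b -> logq a = logq b ->
  perm_eq a b \/ perm_eq a (map_tuple (fun x => 1 - x) b).
Proof.
have [x [y ->]] := centred2_ex a; have [x' [y' ->]] := centred2_ex b => ha hb e.
rewrite centred2_reflect.
have [+ + _] := logq_coefs (centred2 x y); have [+ + _] := logq_coefs (centred2 x' y').
have [-> ->] := par_centred2 ha; have [-> ->] := par_centred2 hb; rewrite e => -> -> e1 e2.
rewrite !logq1_two in e1; have d2 : x * y = x' * y' by clear -e1; lra.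
rewrite d2 in e2; have := logq2_two_diff (x + y) (x' + y') (x' * y'); rewrite e2 subrr.
move=> /esym/eqP; rewrite mulf_eq0 invr_eq0 orbF oppr_eq0 subr_sqr mulf_eq0.
move=> e3; clear e e1 e2 ha hb; case/orP: e3 => /eqP e3; [left|right]; apply: centred2_perm;
  rewrite ?mulrNN //; clear -e3; lra.
Qed.

Lemma selfdual3 x y z : in01 (centred3 x y z) ->
  logq (centred3 (- x) (- y) (- z)) = logq (centred3 x y z) ->
  x + y + z = 0 /\ x * y * z = 0.
Proof.
move=> ha e; have hb := in01_reflect ha; rewrite centred3_reflect in hb.
have := logq_coefs (centred3 x y z); have := logq_coefs (centred3 (- x) (- y) (- z)).
have [-> ->] := par_centred3 ha; have [-> ->] := par_centred3 hb; rewrite e.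
have -> : - x - y - z = - (x + y + z) by ring.
have -> : - x * - y + - x * - z + - y * - z = x * y + x * z + y * z by ring.
have -> : - x * - y * - z = - (x * y * z) by ring.
have /andP[xl xu] : - h < x < h by apply: (bnd ha); rewrite !inE eqxx ?orbT.
have /andP[yl yu] : - h < y < h by apply: (bnd ha); rewrite !inE eqxx ?orbT.
have /andP[zl zu] : - h < z < h by apply: (bnd ha); rewrite !inE eqxx ?orbT.
have b1 : - (3%:R / 2%:R) < x + y + z < 3%:R / 2%:R.
  by move: xl xu yl yu zl zu; rewrite /h => *; lra.
move: (x + y + z) (_ + _ + y * z) (x * y * z) b1 => c1 c2 c3 b1.
move=> [-> -> ->] [e1 e2 e3].
have := logq1_three_odd c1 c2 c3; rewrite e1 subrr => c3E.
have {}c3E : c3 = c1 / 12%:R by clear -c3E; lra.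
subst c3; have := logq2_three_odd c1 c2; rewrite /= e2 subrr => /esym/eqP.
rewrite mulf_eq0 invr_eq0 orbF mulf_eq0 => /orP[/eqP->|/eqP c2E].
  by rewrite mul0r; clear; split.
have {}c2E : c2 = 3%:R / 4%:R by clear -c2E; lra.
subst c2; have := logq3_three_odd c1; rewrite /= e3 subrr => /esym/eqP.
rewrite mulf_eq0 invr_eq0 orbF mulf_eq0 => /orP[/eqP->|/eqP c1E].
  by rewrite mul0r; clear; split.
by clear -b1 c1E; nra.
Qed.

Lemma logq_inj3 (a b : 3.-tuple rat) : in01 a -> in01 b -> logq a = logq b ->
  logq (map_tuple (fun x => 1 - x) a) = logq a ->
  logq (map_tuple (fun x => 1 - x) b) = logq b -> perm_eq a b.
Proof.
have [x [y [z ->]]] := centred3_ex a; have [x' [y' [z' ->]]] := centred3_ex b => ha hb e.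
rewrite !centred3_reflect => /(selfdual3 ha)[c1 c3] /(selfdual3 hb)[c1' c3'].
have [+ _ _] := logq_coefs (centred3 x y z); have [+ _ _] := logq_coefs (centred3 x' y' z').
have [-> ->] := par_centred3 ha; have [-> ->] := par_centred3 hb; rewrite e c1 c3 c1' c3' => ->.
rewrite !logq1_three_even => e1; apply: centred3_perm;
  rewrite ?c1 ?c3 ?c1' ?c3' //; clear -e1; lra.
Qed.

Lemma selfdual4 x y z w : in01 (centred4 x y z w) ->
  logq (centred4 (- x) (- y) (- z) (- w)) = logq (centred4 x y z w) ->
  x + y + z + w = 0 /\ x * y * z + x * y * w + x * z * w + y * z * w = 0.
Proof.
move=> ha e; have hb := in01_reflect ha; rewrite centred4_reflect in hb.
have := logq_coefs (centred4 x y z w); have := logq_coefs (centred4 (- x) (- y) (- z) (- w)).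
have [-> ->] := par_centred4 ha; have [-> ->] := par_centred4 hb; rewrite e.
have -> : - x - y - z - w = - (x + y + z + w) by ring.
have -> : - x * - y + - x * - z + - x * - w + - y * - z + - y * - w + - z * - w =
  x * y + x * z + x * w + y * z + y * w + z * w by ring.
have -> : - x * - y * - z + - x * - y * - w + - x * - z * - w + - y * - z * - w =
  - (x * y * z + x * y * w + x * z * w + y * z * w) by ring.
have -> : - x * - y * - z * - w = x * y * z * w by ring.
have /andP[xl xu] : - h < x < h by apply: (bnd ha); rewrite !inE eqxx ?orbT.
have /andP[yl yu] : - h < y < h by apply: (bnd ha); rewrite !inE eqxx ?orbT.
have /andP[zl zu] : - h < z < h by apply: (bnd ha); rewrite !inE eqxx ?orbT.
have /andP[wl wu] : - h < w < h by apply: (bnd ha); rewrite !inE eqxx ?orbT.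
have b1 : - 2%:R < x + y + z + w < 2%:R.
  by move: xl xu yl yu zl zu wl wu; rewrite /h => *; lra.
move: (x + y + z + w) (_ + z * w) (_ + y * z * w) (x * y * z * w) b1.
move=> c1 c2 c3 c4 b1 [-> -> ->] [e1 e2 e3].
have := logq1_four_odd c1 c2 c3 c4; rewrite e1 subrr => c3E.
have {}c3E : c3 = c1 / 4%:R by clear -c3E; lra.
subst c3; have := logq2_four_odd c1 c2 c4; rewrite /= e2 subrr => /esym/eqP.
rewrite mulf_eq0 invr_eq0 orbF mulf_eq0 => /orP[/eqP->|/eqP c2E].
  by rewrite mul0r; clear; split.
have {}c2E : c2 = 3%:R / 2%:R by clear -c2E; lra.
subst c2; have := logq3_four_odd c1 c4; rewrite /= e3 subrr => /esym/eqP.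
rewrite mulf_eq0 invr_eq0 orbF mulf_eq0 => /orP[/eqP->|/eqP c1E].
  by rewrite mul0r; clear; split.
by clear -b1 c1E; nra.
Qed.

(** Roots [x, ..., w] with vanishing sum have
    [2 c2 = - (x ^ 2 + y ^ 2 + z ^ 2 + w ^ 2)]. *)
Lemma selfdual4_bounds x y z w : in01 (centred4 x y z w) -> x + y + z + w = 0 ->
  x * y + x * z + x * w + y * z + y * w + z * w <= 0 /\
  - (16%:R^-1) < x * y * z * w.
Proof.
move=> ha c1.
have /andP[xl xu] : - h < x < h by apply: (bnd ha); rewrite !inE eqxx ?orbT.
have /andP[yl yu] : - h < y < h by apply: (bnd ha); rewrite !inE eqxx ?orbT.
have /andP[zl zu] : - h < z < h by apply: (bnd ha); rewrite !inE eqxx ?orbT.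
have /andP[wl wu] : - h < w < h by apply: (bnd ha); rewrite !inE eqxx ?orbT.
have M (u v k : rat) : - k < u -> u < k -> - k < v -> v < k ->
    - (k * k) < u * v /\ u * v < k * k.
  clear; move=> h1 h2 h3 h4.
  have A : 0 < (k - u) * (k + v) + (k + u) * (k - v).
    by rewrite addr_gt0 // mulr_gt0 //; lra.
  have B : 0 < (k - u) * (k - v) + (k + u) * (k + v).
    by rewrite addr_gt0 // mulr_gt0 //; lra.
  by split; lra.
split.
  have : (x + y + z + w) ^+ 2 = 0 by rewrite c1 expr0n.
  have := sqr_ge0 x; have := sqr_ge0 y; have := sqr_ge0 z; have := sqr_ge0 w.
  by move=> *; lra.
have [p1 p2] := M _ _ _ xl xu yl yu; have [q1 q2] := M _ _ _ zl zu wl wu.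
have [r1 r2] := M _ _ _ p1 p2 q1 q2; rewrite -mulrA.
by move: r1; rewrite /h => r1; lra.
Qed.

Lemma logq_inj4 (a b : 4.-tuple rat) : in01 a -> in01 b -> logq a = logq b ->
  logq (map_tuple (fun x => 1 - x) a) = logq a ->
  logq (map_tuple (fun x => 1 - x) b) = logq b -> perm_eq a b.
Proof.
have [x [y [z [w ->]]]] := centred4_ex a; have [x' [y' [z' [w' ->]]]] := centred4_ex b => ha hb e.
rewrite !centred4_reflect => /(selfdual4 ha)[c1 c3] /(selfdual4 hb)[c1' c3'].
have [b2 b4] := selfdual4_bounds ha c1; have [b2' b4'] := selfdual4_bounds hb c1'.
have [+ + _] := logq_coefs (centred4 x y z w); have [+ + _] := logq_coefs (centred4 x' y' z' w').
have [-> ->] := par_centred4 ha; have [-> ->] := par_centred4 hb; rewrite e c1 c3 c1' c3' => -> ->.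
rewrite !logq1_four_even => e1.
have c4 : x * y * z * w = x' * y' * z' * w' by clear -e1; lra.
move=> e2; have c2 : x * y + x * z + x * w + y * z + y * w + z * w =
    x' * y' + x' * z' + x' * w' + y' * z' + y' * w' + z' * w'.
  move: e2 b2 b2' b4; rewrite c4.
  move: (_ + z * w) (_ + z' * w') (x' * y' * z' * w') => c2 c2' d e2 b2 b2' b4.
  have := logq2_four_even_diff c2 c2' d; rewrite e2 subrr => /esym/eqP.
  rewrite mulf_eq0 invr_eq0 orbF mulf_eq0 subr_eq0 => /orP[/eqP//|/eqP eS].
  by clear -b2 b2' b4 eS; lra.
by clear e1 e2; apply: centred4_perm => //; rewrite ?c1 ?c3.
Qed.

End Few.

Theorem N_integral_dwork_cond n (a : n.-tuple rat) :
  (0 < n <= 4)%N -> (forall i, 0 < tnth a i < 1) ->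
  N_integral (mirror_map a) -> forall p, good_prime a p -> dwork_cond a p.
Proof.
move=> n4 ha hN p gp; have [hb ba ra rb] := logq_invariance ha hN gp.
rewrite /dwork_cond; move: hb ba ra rb; set b := map_tuple (dwork p) a.
rewrite -[map (dwork p) a]/(val b) -[map (fun x => 1 - x) a]/(val (map_tuple (fun x => 1 - x) a)).
move: b => b {hN gp}; case: n n4 a ha b => [|[|[|[|[|n]]]]] // _ a ha b hb ba ra rb /=.
- exact: logq_inj1.
- exact: logq_inj2.
- exact: logq_inj3.
- exact: logq_inj4.
Qed.

Theorem theorem1 (n : nat) (a : n.-tuple rat)
    (hn : (1 <= n)%N)
    (ha : forall i : 'I_n, 0 < tnth a i < 1) :
  ((forall p : nat, good_prime a p -> dwork_cond a p ->
      p_integral p (mirror_map a))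
   /\ ((forall p : nat, good_prime a p -> dwork_cond a p) ->
       N_integral (mirror_map a)))
  /\ ((n <= 4)%N ->
      (N_integral (mirror_map a) <->
       forall p : nat, good_prime a p -> dwork_cond a p)).
Proof.
split; first split.
- by move=> p; apply: dwork_cond_p_integral.
- exact: dwork_cond_N_integral.
- move=> n4; split; last exact: dwork_cond_N_integral.
  by apply: N_integral_dwork_cond; rewrite ?hn.
Qed.
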